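(* Let $\{\Psi_\rho\}$ be a $\mathcal C^1$-wavelet family on $\mathcal S^n$ with the property that $\{\Psi_{\rho_j,x}:\ j\in\mathbb N_0,\ x\in\mathcal S^n\}$ is a semi-continuous frame. Then, for each $j\in\mathbb N_0$ there exist sequences $(\delta_n^j,\delta_{n-1}^j,\dots,\delta_1^j)$ such that $$ \{\Psi_{\rho_j}(\Upsilon_{(\alpha_n^j,\dots,\alpha_1^j)}^{-1}\,\cdot\,):\ j\in\mathbb N_0,\ \Upsilon_{(\alpha_n^j,\dots,\alpha_1^j)}\in\Lambda^j\} $$ is a frame for $\mathcal L^2(\mathcal S^n)$, provided that $\Lambda^j$ is a grid of type $(\delta_n^j,\delta_{n-1}^j,\dots,\delta_1^j)$ for each $j$.
   Context: $\mathcal S^J\subset\mathbb R^{J+1}$ is the unit sphere with rotation-invariant surface measure $\sigma_J$ of total mass $\Sigma_J=2\pi^{(J+1)/2}/\Gamma((J+1)/2)$. The scalar product on $\mathcal L^2(\mathcal S^n)$ is $\langle f,g\rangle=\frac1{\Sigma_n}\int_{\mathcal S^n}\overline{f(x)}\,g(x)\,d\sigma_n(x)$, and $\|f\|^2=\langle f,f\rangle$. $\nu$ is the invariant unit measure on the rotation group $SO(n+1)$. Wavelet family: let $\mathcal H_l(\mathcal S^n)$ be the space of hyperspherical harmonics of degree $l$, of dimension $N(n,l)=\frac{(n+2l-1)(n+l-2)!}{(n-1)!\,l!}$, with orthonormal basis $\{Y_l^\kappa\}_{\kappa=1}^{N(n,l)}$, and let $a_l^\kappa(f)=\langle Y_l^\kappa,f\rangle$.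 For a weight function $\alpha:\mathbb R_+\to\mathbb R_+$, a family $\{\Psi_\rho\}_{\rho\in\mathbb R_+}\subseteq\mathcal L^2(\mathcal S^n)$ is a wavelet family (of some order $m$) if, with $\beta(l)=\frac{1}{N(n,l)}\sum_{\kappa=1}^{N(n,l)}\int_0^\infty|a_l^\kappa(\Psi_\rho)|^2\,\alpha(\rho)\,d\rho$, one has $\beta(l)=0$ for $l\in\mathbb N_0$, $l\le m$, and $A_0\le\beta(l)\le B_0$ for all $l\in\mathbb N_0$, $l>m$, with positive constants $A_0,B_0$ independent of $l$. It is a $\mathcal C^1$-wavelet family if each $\Psi_\rho$ is continuously differentiable on $\mathcal S^n$. Frame: a family $\{g_y:y\in Y\}$ in a Hilbert space $\mathcal H$, indexed by a measure space $Y$ with a positive measure $\mu$, is a frame with weight $\mu$ if $y\mapsto\langle g_y,u\rangle$ is measurable for each $u\in\mathcal H$ and there are constants $0<A\le B$ with $A\|u\|^2\le\int_Y|\langle g_y,u\rangle|^2\,d\mu(y)\le B\|u\|^2$ for all $u\in\mathcal H$. Semi-continuous frame: $(\rho_j)_{j\in\mathbb N_0}$ is a sequence of scales in $\mathbb R_+$, and $\Psi_{\rho_j,x}$ denotes the rotated copies $\Psi_{\rho_j}(\Upsilon^{-1}\,\cdot\,)$ of $\Psi_{\rho_j}$, where $\Upsilon$ runs through all of $SO(n+1)$ and $x=\Upsilon\widehat e$, $\widehat e=(1,0,\dots,0)$, is the position on the sphere. Semi-continuous means that the scales are discrete, with positive weights $w_j$, while rotations are continuous, with the measure $\nu$; the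 frame is for $\mathcal L^2(\mathcal S^n)$, i.e. $A\|f\|^2\le\sum_jw_j\int_{SO(n+1)}|\langle\Psi_{\rho_j}(\Upsilon^{-1}\,\cdot\,),f\rangle|^2\,d\nu(\Upsilon)\le B\|f\|^2$ for all $f\in\mathcal L^2(\mathcal S^n)$. Parameterization of rotations: let $\Upsilon_\iota(\theta)$ be the rotation in the plane $(x_\iota,x_{\iota+1})$ with rotation angle $\theta$. Write $x^1=\varphi^1\in\mathcal S^1$ and $x^J=(\theta_1^J,\dots,\theta_{J-1}^J,\varphi^J)\in\mathcal S^J$ (spherical coordinates, $\theta_\iota^J\in[0,\pi]$, $\varphi^J\in[0,2\pi)$) for $J=2,\dots,n$. A rotation $\Upsilon\in SO(n+1)$ is represented as $\Upsilon=\Upsilon^1\,\Upsilon^2\cdots\Upsilon^n$ with $$\Upsilon^J(x^J)=\Upsilon_1(\theta_1^J)\,\Upsilon_2(\theta_2^J)\cdots\Upsilon_{J-1}(\theta_{J-1}^J)\,\Upsilon_J(\varphi^J),\qquad J=1,2,\dots,n,$$ where $\theta_\iota^J$ and $\varphi^J$ are the Euler angles of $\Upsilon$; thus $SO(n+1)$ is interpreted as the Cartesian product of $\mathcal S^J$, $J=1,\dots,n$. Grid of type $(\delta_n,\delta_{n-1},\dots,\delta_1)$ (positive numbers): a discrete measurable set $\Lambda$ of rotations in $SO(n+1)$, constructed iteratively as follows. There is a measurable partition $\{\mathcal O^n_{\alpha_n}:\alpha_n=1,\dots,K_n\}$ of $\mathcal S^n$ into simply connected sets such that the diameter of each set (in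 geodesic distance) is not larger than $\delta_n$. Each of these sets contains exactly one point $x^n_{\alpha_n}$. For $J<n$ and each fixed multi-index $(\alpha_n,\dots,\alpha_{J+1})$ there is a measurable partition $\{\mathcal O^J_{\alpha_J}:\alpha_J=1,\dots,K_J\}$ of $\mathcal S^J$ into $K_J=K_J(\alpha_n,\dots,\alpha_{J+1})$ simply connected sets of diameter not larger than $\delta_J$ (the partition may depend on the multi-index), each of them containing exactly one point $x^J_{\alpha_J}=x^J_{(\alpha_n,\dots,\alpha_J)}$. Then $\Lambda$ is the set of rotations $$\Upsilon_{(\alpha_n,\dots,\alpha_1)}=\Upsilon^1(x^1_{\alpha_1})\,\Upsilon^2(x^2_{\alpha_2})\cdots\Upsilon^n(x^n_{\alpha_n})$$ with the measure $\lambda(\Upsilon_{(\alpha_n,\dots,\alpha_1)})=\prod_{J=1}^n\lambda^J(x^J_{\alpha_J})$, $\lambda^J(x^J_{\alpha_J})=\sigma_J(\mathcal O^J_{\alpha_J})$. The weight of the discrete frame in the conclusion is given by the scale weights $w_j$ times the grid measure $\lambda$ of $\Lambda^j$ (up to a normalizing constant).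
   Formalization: For J < n, the factor Υ^J is taken to act on the last J+1 coordinates (planes (x_{n-J+ι}, x_{n-J+ι+1})) instead of the printed planes (x_ι, x_{ι+1}), since the printed products do not fill SO(n+1) and the claim fails for zonal wavelets when n ≥ 2. *)

(* Defs.v *)
From HB Require Import structures.
From mathcomp Require Import all_boot all_order all_algebra.
From mathcomp.multinomials Require mpoly.

Set Implicit Arguments.
Unset Strict Implicit.
Unset Printing Implicit Defensive.

(* In a module because the notations of mpoly clash with those of analysis. *)
Module HarmonicPoly.
Import GRing.Theory.
Import mpoly.
Local Open Scope ring_scope.

(* Homogeneous of degree l, with vanishing Laplacian. *)
Definition harmonic_form n (C : comNzRingType) (l : nat)
    (p : {mpoly C[n]}) : Prop :=
  p \is l.-homog /\ \sum_(i < n) p^`M(i)^`M(i) = 0.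

Definition eval n (C : comNzRingType) (p : {mpoly C[n]}) (v : 'I_n -> C) : C :=
  p.@[v].

End HarmonicPoly.

From mathcomp Require Import all_classical all_reals all_analysis.
From mathcomp.real_closed Require Import complex.
Import Order.TTheory GRing.Theory Num.Theory.
Import numFieldNormedType.Exports.

Local Open Scope classical_set_scope.
Local Open Scope ring_scope.

Notation borel T := (g_sigma_algebraType (@open T)).

(* Complex-valued functions on S^n.  Here and below, a function on the sphere is
   a total function on the ambient R^(n+1) of which only the restriction to the
   sphere matters, and a measure on the sphere (resp. on SO(n+1)) is a Borel
   measure on R^(n+1) (resp. on the square matrices) carried by it. *)
Notation sphfun R n := ('cV[R]_n.+1 -> complex R).
Notation vmeasure R m := {measure set (borel 'cV[R]_m) -> \bar R}.
Notation mxmeasure R n := {measure set (borel 'M[R]_n.+1) -> \bar R}.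

Section Sphere.
Variable R : realType.

Definition dotv m (x y : 'cV[R]_m) : R := \sum_(i < m) x i 0 * y i 0.

Definition sphere J : set 'cV[R]_J.+1 := [set x | dotv x x = 1].
Arguments sphere : clear implicits.

Definition geodist m (x y : 'cV[R]_m) : R := acos (dotv x y).

Definition rotations n : set 'M[R]_n.+1 :=
  [set U | U *m U^T = 1%:M /\ \det U = 1].
Arguments rotations : clear implicits.

Definition Gamma (s : R) : R :=
  \int[@lebesgue_measure R]_(t in `]0, +oo[) (t `^ (s - 1) * expR (- t)).

(* Total mass of the sphere S^J. *)
Definition Sigma (J : nat) : R :=
  2 * pi `^ (J.+1%:R / 2) / Gamma (J.+1%:R / 2).

(* For J >= 1 these properties determine the measure. *)
Definition surface_measure J (sigma : vmeasure R J.+1) : Prop :=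
  [/\ sigma (~` sphere J) = 0%E,
      sigma (sphere J) = (Sigma J)%:E &
      forall (U : 'M[R]_J.+1) (A : set (borel 'cV[R]_J.+1)),
        rotations J U -> measurable A -> sigma (mulmx U @^-1` A) = sigma A].

Definition invariant_unit_measure n (nu : mxmeasure R n) : Prop :=
  [/\ nu (~` rotations n) = 0%E,
      nu (rotations n) = 1%E &
      forall (U : 'M[R]_n.+1) (A : set (borel 'M[R]_n.+1)),
        rotations n U -> measurable A ->
        nu (mulmx U @^-1` A) = nu A /\ nu (mulmxr U @^-1` A) = nu A].

End Sphere.

Arguments sphere {R} J _.
Arguments rotations {R} n _.

Section L2.
Variables (R : realType) (n : nat) (sigma : vmeasure R n.+1).
Implicit Types f g : sphfun R n.

Definition csqnorm (z : complex R) : R := complex.Re z ^+ 2 + complex.Im z ^+ 2.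

Definition measurable_cfun d (T : measurableType d) (D : set T)
    (f : T -> complex R) : Prop :=
  measurable_fun D (fun x => complex.Re (f x)) /\
  measurable_fun D (fun x => complex.Im (f x)).

Definition cintegral (f : sphfun R n) : complex R :=
  Complex (\int[sigma]_(x in sphere n) complex.Re (f x))
          (\int[sigma]_(x in sphere n) complex.Im (f x)).

Definition in_L2 f : Prop :=
  measurable_cfun (sphere n : set (borel 'cV[R]_n.+1)) f /\
  (\int[sigma]_(x in sphere n) (csqnorm (f x))%:E < +oo)%E.

Definition inner f g : complex R :=
  real_complex R (Sigma R n)^-1 * cintegral (fun x => conjc (f x) * g x).

Definition sqnormL2 f : R := complex.Re (inner f f).

Definition is_frame d (Y : measurableType d) (D : set Y)
    (mu : {measure set Y -> \bar R}) (g : Y -> sphfun R n) : Prop :=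
  [/\ measurable D,
      forall y, D y -> in_L2 (g y),
      forall u, in_L2 u -> measurable_cfun D (fun y => inner (g y) u) &
      exists A B : R, [/\ 0 < A, A <= B & forall u, in_L2 u ->
        ((A * sqnormL2 u)%:E <=
           \int[mu]_(y in D) (csqnorm (inner (g y) u))%:E <=
         (B * sqnormL2 u)%:E)%E]].

(* Restrictions to S^n of harmonic homogeneous polynomials of degree l. *)
Definition hyperspherical_harmonic (l : nat) f : Prop :=
  exists p : mpoly.mpoly n.+1 (complex R),
    HarmonicPoly.harmonic_form l p /\
    forall x, sphere n x ->
      f x = HarmonicPoly.eval p (fun i => real_complex R (x i 0)).

(* N(n, l); the case l = 0 is singled out because the general expression is
   meaningless for n = 1, l = 0 (for n >= 2 it gives 1 as well). *)
Definition Nharm (m l : nat) : nat :=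
  if l == 0%N then 1%N else
  (((m + 2 * l - 1) * (m + l - 2)`!) %/ ((m - 1)`! * l`!))%N.

Definition harmonic_onb (Y : forall l, 'I_(Nharm n l) -> sphfun R n) : Prop :=
  forall l : nat,
    [/\ forall k, hyperspherical_harmonic l (Y l k),
        forall k k', inner (Y l k) (Y l k') = (k == k')%:R &
        forall f, hyperspherical_harmonic l f ->
          exists c : 'I_(Nharm n l) -> complex R,
            forall x, sphere n x -> f x = \sum_k c k * Y l k x].

Definition beta (Y : forall l, 'I_(Nharm n l) -> sphfun R n) (alpha : R -> R)
    (Psi : R -> sphfun R n) (l : nat) : \bar R :=
  ((Nharm n l)%:R^-1%:E * \sum_(k < Nharm n l)
     \int[@lebesgue_measure R]_(rho in (`]0, +oo[%classic)%R)
       (csqnorm (inner (Y l k) (Psi rho)) * alpha rho)%:E)%E.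

(* The order m is an integer: m = -1 means that no beta l is required to vanish.
   The measurability clause gives a meaning to the integrals in beta. *)
Definition wavelet_family (Y : forall l, 'I_(Nharm n l) -> sphfun R n)
    (alpha : R -> R) (Psi : R -> sphfun R n) : Prop :=
  [/\ forall rho, 0 < rho -> in_L2 (Psi rho),
      forall l k, @measurable_fun _ _ R R `]0, +oo[
        (fun rho => csqnorm (inner (Y l k) (Psi rho)) * alpha rho) &
      exists (m : int) (A0 B0 : R), [/\ 0 < A0, 0 < B0,
        forall l : nat, l%:Z <= m -> beta Y alpha Psi l = 0%E &
        forall l : nat, m < l%:Z ->
          (A0%:E <= beta Y alpha Psi l <= B0%:E)%E]].

Definition C1_on (W : set 'cV[R]_n.+1) (F : 'cV[R]_n.+1 -> R) : Prop :=
  (forall y, W y -> differentiable F y) /\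
  (forall v y, W y -> {for y, continuous (fun z => 'D_v F z)}).

(* Continuous differentiability on the submanifold S^n: f is locally the
   restriction of a C^1 function of the ambient space. *)
Definition C1_sphere f : Prop :=
  forall x, sphere n x ->
    exists (W : set 'cV[R]_n.+1) (F G : 'cV[R]_n.+1 -> R),
      [/\ open W, W x, C1_on W F, C1_on W G &
          forall y, W y -> sphere n y -> f y = Complex (F y) (G y)].

Definition C1_wavelet_family (Y : forall l, 'I_(Nharm n l) -> sphfun R n)
    (alpha : R -> R) (Psi : R -> sphfun R n) : Prop :=
  wavelet_family Y alpha Psi /\ forall rho, 0 < rho -> C1_sphere (Psi rho).

End L2.

Section SimplyConnected.
Variables (R : realType) (T : topologicalType).
Implicit Type A : set T.

Definition path_in A (gamma : R -> T) : Prop :=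
  {within `[0, 1], continuous gamma} /\ gamma @` `[0, 1] `<=` A.

Definition path_connected A : Prop :=
  A !=set0 /\ forall x y, A x -> A y ->
    exists gamma, [/\ path_in A gamma, gamma 0 = x & gamma 1 = y].

Definition null_homotopic A (gamma : R -> T) : Prop :=
  exists H : R * R -> T,
    [/\ {within `[0, 1] `*` `[0, 1], continuous H},
        H @` (`[0, 1] `*` `[0, 1]) `<=` A,
        forall t, t \in `[0, 1] -> H (0, t) = gamma t /\ H (1, t) = gamma 0 &
        forall s, s \in `[0, 1] -> H (s, 0) = gamma 0 /\ H (s, 1) = gamma 0].

Definition simply_connected A : Prop :=
  path_connected A /\
  forall gamma, path_in A gamma -> gamma 0 = gamma 1 -> null_homotopic A gamma.

End SimplyConnected.

Section Grids.
Variable R : realType.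

(* A point of S^J, J >= 1, is given by its spherical coordinates, listed in
   t : 'rV_J as (theta_1, ..., theta_(J-1), phi). *)
Definition spherical_coordinates J (t : 'rV[R]_J) : Prop :=
  forall k : 'I_J, 0 <= t 0 k /\
    (if k.+1 == J then t 0 k < 2 * pi else t 0 k <= pi).

(* x_1 = cos theta_1, x_2 = sin theta_1 cos theta_2, ...,
   x_J = sin theta_1 ... sin theta_(J-1) cos phi,
   x_(J+1) = sin theta_1 ... sin theta_(J-1) sin phi *)
Definition sphere_point J (t : 'rV[R]_J) : 'cV[R]_J.+1 :=
  \col_(i < J.+1) ((\prod_(k < J | (k < i)%N) sin (t 0 k)) *
                   (\prod_(k < J | k == i :> nat) cos (t 0 k))).

(* Rotation of R^(n+1) with angle a in the plane of the coordinates with indices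
   k, k+1, counted from 0. *)
Definition plane_rotation n (k : nat) (a : R) : 'M[R]_n.+1 :=
  \matrix_(i, j)
    if (i == k :> nat) && (j == k :> nat) then cos a
    else if (i == k.+1 :> nat) && (j == k.+1 :> nat) then cos a
    else if (i == k :> nat) && (j == k.+1 :> nat) then - sin a
    else if (i == k.+1 :> nat) && (j == k :> nat) then sin a
    else (i == j)%:R.

(* Upsilon^J = Upsilon_1(theta_1) ... Upsilon_(J-1)(theta_(J-1)) Upsilon_J(phi),
   an element of SO(J+1), which sits in SO(n+1) by acting on the last J+1
   coordinates, i.e. as the rotations fixing the first n-J coordinate vectors;
   hence the shift by n - J.  With it, Upsilon^1 ... Upsilon^n runs through the
   whole of SO(n+1), and the product of the surface measures becomes a multiple
   of the invariant measure.  If SO(J+1) acted on the first J+1 coordinates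
   instead, then already for n = 2 the products
     Upsilon_1(phi^1) Upsilon_1(theta_1^2) Upsilon_2(phi^2)
   would only fill a two-dimensional subset of SO(3). *)
Definition Upsilon n J (t : 'rV[R]_J) : 'M[R]_n.+1 :=
  \prod_(k < J) plane_rotation n (n - J + k) (t 0 k).

(* Data of the levels J, J-1, ..., 1 of a grid: at the level J+1, a number K of
   sets D 0, ..., D (K-1) of S^(J+1), the coordinates t a of a point of each of
   them and, for each a, the data of the lower levels, which may thus depend on
   the indices already chosen (the values at a >= K are irrelevant). *)
Inductive grid : nat -> Type :=
| GridNil : grid 0
| GridCons : forall (J K : nat) (D : nat -> set (borel 'cV[R]_J.+2))
    (t : nat -> 'rV[R]_J.+1) (sub : nat -> grid J), grid J.+1.

Fixpoint grid_of_type (sigma : forall J, vmeasure R J.+1) (delta : nat -> R)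
    J (g : grid J) : Prop :=
  match g with
  | GridNil => True
  | GridCons J K D t sub =>
      partition `I_K D (sphere J.+1) /\
      forall a, (a < K)%N ->
        [/\ measurable (D a),
            simply_connected R (D a : set 'cV[R]_J.+2),
            forall x y, D a x -> D a y -> geodist x y <= delta J.+1,
            spherical_coordinates (t a) /\ D a (sphere_point (t a)) &
            grid_of_type sigma delta (sub a)]
  end.

(* The set of the rotations Upsilon^1(x^1) ... Upsilon^J(x^J) V given by the
   multi-indices of g; Lambda is obtained for J = n and V = 1. *)
Fixpoint grid_set n J (g : grid J) (V : 'M[R]_n.+1) :
    set (borel 'M[R]_n.+1) :=
  match g with
  | GridNil => [set V]
  | GridCons J K D t sub =>
      \bigcup_(a in `I_K) grid_set (sub a) (Upsilon n (t a) *m V)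
  end.

(* The discrete measure putting on these rotations the products of the measures
   of the sets containing the points x^1, ..., x^J. *)
Fixpoint grid_measure (sigma : forall J, vmeasure R J.+1) n J (g : grid J)
    (V : 'M[R]_n.+1) : mxmeasure R n :=
  match g with
  | GridNil => dirac (V : borel 'M[R]_n.+1)
  | GridCons J K D t sub =>
      msum (fun a =>
        mscale (NngNum (fine_ge0 (measure_ge0 (sigma J.+1) (D a))))
               (grid_measure sigma (sub a) (Upsilon n (t a) *m V))) K
  end.

End Grids.

(* Measures on families indexed by a scale j : nat and a rotation. *)
Section ScaleMeasure.
Variables (R : realType) (d : measure_display) (T : measurableType d).

Section Slice.
Variables (j : nat) (mu : {measure set T -> \bar R}).

Definition at_scale (A : set (nat * T)) : \bar R := mu (xsection A j).

Let at_scale0 : at_scale set0 = 0%E.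
Proof. by rewrite /at_scale xsection0 measure0. Qed.

Let at_scale_ge0 A : (0 <= at_scale A)%E.
Proof. exact: measure_ge0. Qed.

Let at_scale_sigma_additive : semi_sigma_additive at_scale.
Proof.
move=> F mF tF mUF; rewrite /at_scale xsection_bigcup.
apply: measure_semi_sigma_additive.
- by move=> i; exact: measurable_xsection.
- exact: trivIset_xsection.
- by rewrite -xsection_bigcup; exact: measurable_xsection.
Qed.

HB.instance Definition _ := isMeasure.Build _ _ _ at_scale
  at_scale0 at_scale_ge0 at_scale_sigma_additive.

End Slice.

(* The sum over j of w_j times the measure mu_j placed on {j} x T. *)
Definition scale_measure (w : nat -> {posnum R})
    (mu : nat -> {measure set T -> \bar R}) :
    {measure set (nat * T) -> \bar R} :=
  mseries (fun j => mscale (w j)%:num%:nng (at_scale j (mu j))) 0.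

End ScaleMeasure.

Definition rotated_wavelets (R : realType) (n : nat) (Psi : R -> sphfun R n)
    (rho : nat -> R) (y : nat * borel 'M[R]_n.+1) : sphfun R n :=
  fun x => Psi (rho y.1) (invmx y.2 *m x).

Definition semicontinuous_frame (R : realType) (n : nat)
    (sigma : vmeasure R n.+1) (nu : mxmeasure R n) (Psi : R -> sphfun R n)
    (rho : nat -> R) (w : nat -> {posnum R}) : Prop :=
  is_frame sigma [set y : nat * borel 'M[R]_n.+1 | rotations n y.2]
    (scale_measure w (fun=> nu))
    (rotated_wavelets Psi rho).

Definition discrete_frame (R : realType) (n : nat)
    (sigma : forall J, vmeasure R J.+1) (Lambda : nat -> grid R n)
    (Psi : R -> sphfun R n) (rho : nat -> R) (w : nat -> {posnum R}) : Prop :=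
  is_frame (sigma n)
    [set y : nat * borel 'M[R]_n.+1 |
      grid_set (Lambda y.1) 1%:M y.2]
    (scale_measure w (fun j => grid_measure sigma (Lambda j) 1%:M))
    (rotated_wavelets Psi rho).

(* Main.v *)
(* Fix a scale and a function u, and let F(U) be the squared modulus of the
   scalar product of u with the wavelet rotated by U.  As the wavelet is
   uniformly continuous on the sphere, F varies by at most eps ||u||^2 between
   close rotations, where closeness of U and U' is measured by the trace of
   U^T U', which is invariant under left and right multiplication.

   Let S(V) be the integral of F(. V) against the grid measure.  The point is
   that S(V) is almost independent of V, and even of the grid.  This goes by
   induction on the level: the rotations Upsilon^J(x) h and Upsilon^J(y) are
   close up to a left factor in SO(J), absorbed by the induction hypothesis, as
   soon as y is close to T x, where T is conjugate to h^-1 by a sign matrix; and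
   the cells of the first partition and the preimages by T of the cells of the
   second have a common refinement, with the same total measures by invariance
   of sigma_J.  (The spherical coordinates themselves are not continuous, so F
   cannot be compared directly at neighbouring points.)  Averaging S over V with
   respect to nu, and using the left invariance of nu, shows that S(1) is close
   to the mass of the grid times the integral of F.  With errors summable over
   the scales the frame inequalities carry over, the mass of the grid being
   positive because 0 < Gamma(s) < oo. *)

Require Import Defs.
From HB Require Import structures.
From mathcomp Require Import all_boot all_order all_algebra.
From mathcomp Require Import all_classical all_reals all_analysis.
From mathcomp Require Import measurable_realfun.
From mathcomp.real_closed Require Import complex.
From mathcomp Require Import ring lra zify.
Import Order.TTheory GRing.Theory Num.Theory.
Import numFieldNormedType.Exports.

Set Implicit Arguments.
Unset Strict Implicit.
Unset Printing Implicit Defensive.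

Local Open Scope classical_set_scope.
Local Open Scope ring_scope.

(** * Rotations *)

Section Rotations.
Variable R : realType.

Lemma dotvE m (x y : 'cV[R]_m) : x^T *m y = (dotv x y)%:M.
Proof.
apply/matrixP => i j; rewrite !ord1 !mxE eqxx mulr1n.
by apply: eq_bigr => k _; rewrite !mxE.
Qed.

Lemma dotvC m (x y : 'cV[R]_m) : dotv x y = dotv y x.
Proof. by apply: eq_bigr => k _; rewrite mulrC. Qed.

Lemma dotvDl m (x y z : 'cV[R]_m) : dotv (x + y) z = dotv x z + dotv y z.
Proof. by rewrite -big_split; apply: eq_bigr => k _; rewrite !mxE mulrDl. Qed.

Lemma dotvDr m (x y z : 'cV[R]_m) : dotv z (x + y) = dotv z x + dotv z y.
Proof. by rewrite dotvC dotvDl !(dotvC z). Qed.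

Lemma dotvNl m (x y : 'cV[R]_m) : dotv (- x) y = - dotv x y.
Proof. by rewrite /dotv -sumrN; apply: eq_bigr => k _; rewrite !mxE mulNr. Qed.

Lemma dotvNr m (x y : 'cV[R]_m) : dotv y (- x) = - dotv y x.
Proof. by rewrite dotvC dotvNl dotvC. Qed.

Definition dotvZ := (dotvDl, dotvDr, dotvNl, dotvNr).

Lemma dotv_ge0 m (x : 'cV[R]_m) : 0 <= dotv x x.
Proof. by apply: sumr_ge0 => i _; rewrite -expr2 sqr_ge0. Qed.

Lemma dotv_mul m (U : 'M[R]_m) (x y : 'cV[R]_m) :
  dotv (U *m x) y = dotv x (U^T *m y).
Proof.
have := dotvE (U *m x) y; rewrite trmx_mul -mulmxA dotvE => /matrixP/(_ 0 0).
by rewrite !mxE eqxx !mulr1n.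
Qed.

Lemma dotv_orth m (U : 'M[R]_m) (x y : 'cV[R]_m) :
  U^T *m U = 1%:M -> dotv (U *m x) (U *m y) = dotv x y.
Proof. by move=> U1; rewrite dotv_mul mulmxA U1 mul1mx. Qed.

Lemma dotv_sphere_le1 J (x y : 'cV[R]_J.+1) :
  sphere J x -> sphere J y -> -1 <= dotv x y <= 1.
Proof.
rewrite /sphere /= => x1 y1.
have := dotv_ge0 (x + y); have := dotv_ge0 (x - y).
by rewrite !dotvZ x1 y1 (dotvC y x); lra.
Qed.

(* |x - z|^2 <= 2 |x - y|^2 + 2 |y - z|^2 for unit vectors, whose squared
   distances are 2 - 2 dotv. *)
Lemma dotv_triangle J (x y z : 'cV[R]_J.+1) (e : R) :
  sphere J x -> sphere J y -> sphere J z ->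
  1 - e <= dotv x y -> 1 - e <= dotv y z -> 1 - 4 * e <= dotv x z.
Proof.
rewrite /sphere /= => x1 y1 z1.
have := dotv_ge0 (x - y - (y - z)).
rewrite !dotvZ x1 y1 z1 (dotvC y x) (dotvC z x) (dotvC z y); lra.
Qed.

Lemma rotationsTl n (U : 'M[R]_n.+1) : rotations n U -> U^T *m U = 1%:M.
Proof. by case=> /mulmx1C. Qed.

Lemma rotations1 n : rotations n (1%:M : 'M[R]_n.+1).
Proof. by split; rewrite ?trmx1 ?mulmx1 ?det1. Qed.

Lemma rotationsM n (U V : 'M[R]_n.+1) :
  rotations n U -> rotations n V -> rotations n (U *m V).
Proof.
move=> [U1 dU] [V1 dV]; split; last by rewrite det_mulmx dU dV mulr1.
by rewrite trmx_mul mulmxA -(mulmxA U) V1 mulmx1.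
Qed.

Lemma rotationsT n (U : 'M[R]_n.+1) : rotations n U -> rotations n U^T.
Proof. by move=> rU; split; [rewrite trmxK rotationsTl|rewrite det_tr rU.2].
  Qed.

Lemma rotations_inv n (U : 'M[R]_n.+1) : rotations n U -> invmx U = U^T.
Proof.
move=> [U1 dU]; have Uu : U \in unitmx by rewrite unitmxE dU unitr1.
by rewrite -[RHS]mul1mx -(mulVmx Uu) -mulmxA U1 mulmx1.
Qed.

Lemma sphere_rotation n (U : 'M[R]_n.+1) x :
  rotations n U -> sphere n x -> sphere n (U *m x).
Proof. by move=> rU; rewrite /sphere /= dotv_orth // rotationsTl. Qed.

(** Two factorizations of one block matrix, equated in [E], have [\det (1%:M + u *m v)] and the
    determinant of the 1 x 1 matrix [1%:M + v *m u] as determinants. *)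
Lemma det_add1_rank1 n (u : 'cV[R]_n) (v : 'rV[R]_n) :
  \det (1%:M + u *m v) = 1 + (v *m u) 0 0.
Proof.
have E : block_mx 1%:M 0 v 1%:M *m block_mx (1%:M + u *m v) u 0 1%:M =
         block_mx 1%:M u 0 (1%:M + v *m u) *m block_mx 1%:M 0 v 1%:M.
  rewrite !mulmx_block !(mul1mx, mulmx1, mul0mx, mulmx0, addr0, add0r).
  by rewrite mulmxDr mulmx1 mulmxDl mul1mx mulmxA (addrC 1%:M (v *m u)).
have := congr1 determinant E.
rewrite !det_mulmx !det_lblock !det_ublock !det1 !(mul1r, mulr1) => ->.
by rewrite det_mx11 !mxE eqxx.
Qed.

Section Householder.
Variables (n : nat) (a : R) (v : 'cV[R]_n.+1).
Hypothesis av : a * dotv v v = 2.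

(** Under [av] this is the reflection in the hyperplane orthogonal to [v], which need not be a unit
    vector. *)
Definition householder : 'M[R]_n.+1 := 1%:M - a *: (v *m v^T).

Lemma householder_tr : householder^T = householder.
Proof. by rewrite /householder linearB linearZ /= trmx1 trmx_mul trmxK. Qed.

Lemma householder_sqr : householder *m householder = 1%:M.
Proof.
pose N := v *m v^T.
have NN : N *m N = dotv v v *: N.
  by rewrite /N mulmxA -(mulmxA v) dotvE mul_mx_scalar -scalemxAl.
rewrite /householder -/N mulmxBl mul1mx mulmxBr mulmx1 -scalemxAl -scalemxAr.
rewrite NN !scalerA -mulrA av; apply/matrixP => i j; rewrite !mxE; ring.
Qed.

Lemma det_householder : \det householder = -1.
Proof.
rewrite /householder -scaleNr scalemxAl det_add1_rank1.
by rewrite -scalemxAr dotvE !mxE eqxx mulr1n mulNr av; ring.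
Qed.

End Householder.

(* The rotation of the plane spanned by p and p', as the product of the
   reflections in the hyperplanes orthogonal to p and to p + p'. *)
Lemma rotation_to n (p p' : 'cV[R]_n.+1) (c := dotv p p') :
  sphere n p -> sphere n p' -> -1 < c ->
  exists U : 'M[R]_n.+1,
    [/\ rotations n U, U *m p = p' & \tr U = n.+1%:R - 2 + 2 * c].
Proof.
rewrite /sphere /= => p1 p1' c1.
have c0 : 1 + c != 0 by rewrite gt_eqF// -ltrBlDl sub0r.
(* Since [dotv q q = 2 * (1 + c)], this [a] makes [householder a q] a reflection; [-1 < c] excludes
   the antipodal case [q = 0]. *)
pose a := (1 + c)^-1; pose q := p + p'.
have aq : a * dotv q q = 2.
  by rewrite !dotvZ p1 p1' (dotvC p') -/c /a; field.
have b2 : 2 * dotv p p = 2 by rewrite p1 mulr1.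
pose H := householder a q; pose G := householder 2 p.
have Gp : G *m p = - p.
  rewrite /G /householder mulmxBl mul1mx -scalemxAl -mulmxA dotvE p1 mulmx1.
  by rewrite scaler_nat mulr2n opprD addrA subrr sub0r.
have Hp : H *m (- p) = p'.
  rewrite /H /householder mulmxN mulmxBl mul1mx -scalemxAl -mulmxA dotvE.
  rewrite dotvDl p1 (dotvC p') -/c mul_mx_scalar scalerA mulVf// scale1r.
  by rewrite /q opprB addrAC subrr add0r.
exists (H *m G); split.
- split; last by rewrite det_mulmx !det_householder// mulN1r opprK.
  rewrite trmx_mul !householder_tr mulmxA -(mulmxA H) householder_sqr//.
  by rewrite mulmx1 householder_sqr.
- by rewrite -mulmxA Gp.
(* As [H *m p = - p'], the product [H *m G] is [H + 2 *: (p' *m p^T)]: the trace of [H] is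
   [n.+1%:R - 2], and the other summand adds [2 * c]. *)
- rewrite {1}/G /householder mulmxBr mulmx1 -scalemxAr mulmxA.
  have -> : H *m p = - p' by rewrite -Hp -mulmxN opprK.
  rewrite mulNmx scalerN opprK linearD linearZ /= mxtrace_mulC dotvE.
  rewrite mxtrace_scalar mulr1n -/c; congr (_ + _).
  rewrite /H /householder linearB linearZ /= mxtrace1 mxtrace_mulC dotvE.
  by rewrite mxtrace_scalar mulr1n aq.
Qed.

(** For rotations this says that the squared Frobenius norm of [U - U'] is at most [2 * eta]. *)
Definition near_mx n (eta : R) (U U' : 'M[R]_n.+1) : Prop :=
  n.+1%:R - eta <= \tr (U^T *m U').

Lemma near_mxMl n eta (W U U' : 'M[R]_n.+1) :
  rotations n W -> near_mx eta (W *m U) (W *m U') <-> near_mx eta U U'.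
Proof.
move=> rW; rewrite /near_mx trmx_mul -mulmxA (mulmxA W^T) rotationsTl//.
by rewrite mul1mx.
Qed.

Lemma near_mxMr n eta (W U U' : 'M[R]_n.+1) :
  rotations n W -> near_mx eta (U *m W) (U' *m W) <-> near_mx eta U U'.
Proof.
move=> rW; rewrite /near_mx trmx_mul -mulmxA mxtrace_mulC -!mulmxA rW.1.
by rewrite mulmx1.
Qed.

(** Embeds SO(n+1) into SO(n+2) as the stabilizer of the first basis vector, in agreement with the
    shift of the planes in [Upsilon]. *)
Definition lift0 n (U : 'M[R]_n.+1) : 'M[R]_n.+2 := lift0_mx U.

Lemma lift0M n (U V : 'M[R]_n.+1) : lift0 (U *m V) = lift0 U *m lift0 V.
Proof.
rewrite /lift0 /lift0_mx (@mulmx_block _ 1 n.+1 1 n.+1 1 n.+1).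
by rewrite !(mul1mx, mulmx0, mul0mx, addr0, add0r).
Qed.

Lemma lift01 n : lift0 (1%:M : 'M[R]_n.+1) = 1%:M.
Proof. by rewrite /lift0 /lift0_mx -scalar_mx_block. Qed.

Lemma lift0T n (U : 'M[R]_n.+1) : (lift0 U)^T = lift0 U^T.
Proof.
by rewrite /lift0 /lift0_mx (@tr_block_mx _ 1 n.+1 1 n.+1) trmx1 !trmx0.
Qed.

Lemma mxtrace_lift0 n (U : 'M[R]_n.+1) : \tr (lift0 U) = 1 + \tr U.
Proof. by rewrite (@mxtrace_block _ 1 n.+1) mxtrace1. Qed.

Lemma rotations_lift0 n (U : 'M[R]_n.+1) :
  rotations n.+1 (lift0 U) <-> rotations n U.
Proof.
have dU : \det (lift0 U) = \det U by rewrite (@det_ublock _ 1) det1 mul1r.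
split=> -[U1 dU1]; split; rewrite ?dU// in dU1 *.
  move: U1; rewrite lift0T -lift0M -lift01 => /(congr1 (@drsubmx _ 1 _ 1 _)).
  by rewrite !block_mxKdr.
by rewrite lift0T -lift0M U1 lift01.
Qed.

Lemma near_mx_lift0 n eta (U U' : 'M[R]_n.+1) :
  near_mx eta (lift0 U) (lift0 U') <-> near_mx eta U U'.
Proof.
rewrite /near_mx lift0T -lift0M mxtrace_lift0.
by rewrite -[X in X%:R]addn1 natrD (addrC _ 1) -addrA lerD2l.
Qed.

Definition e0 n : 'cV[R]_n.+1 := delta_mx 0 0.

(** The transpose of [U] fixes [e0] as well, so the first column and the first row of [U] are those
    of the identity. *)
Lemma rotations_fix_e0 n (U : 'M[R]_n.+2) :
  rotations n.+1 U -> U *m e0 n.+1 = e0 n.+1 ->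
  exists2 W, rotations n W & U = lift0 W.
Proof.
move=> rU Ue.
have Ute : U^T *m e0 n.+1 = e0 n.+1.
  by rewrite -{1}Ue mulmxA rotationsTl// mul1mx.
pose W : 'M[R]_n.+1 := @drsubmx _ 1 n.+1 1 n.+1 U.
suff E : U = lift0 W by exists W => //; apply/rotations_lift0; rewrite -E.
have c0 i : U i 0 = (i == 0)%:R.
  have /matrixP/(_ i 0) := Ue; rewrite -colE !mxE => ->.
  by rewrite eqxx andbT.
have r0 i : U 0 i = (i == 0)%:R.
  have /matrixP/(_ i 0) := Ute; rewrite -colE !mxE => ->.
  by rewrite eqxx andbT.
have l0 : lshift n.+1 (0 : 'I_1) = 0 :> 'I_n.+2 by apply/val_inj.
rewrite /lift0 /lift0_mx -[LHS](@submxK _ 1 n.+1 1 n.+1).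
congr (@block_mx _ 1 n.+1 1 n.+1 _ _ _ _); apply/matrixP => i j.
- by rewrite !ord1 !mxE l0 c0.
- by rewrite !ord1 !mxE l0 r0.
- by rewrite !ord1 !mxE l0 c0.
Qed.

(* If P rotates p = U^T e0 to p' = U'^T e0, then U P^T U'^T fixes e0, and its
   product with U' is at distance from U controlled by the trace of P. *)
Lemma coset_near n (eta : R) (U U' : 'M[R]_n.+2) :
  rotations n.+1 U -> rotations n.+1 U' -> eta < 4 ->
  1 - eta / 2 <= dotv (U^T *m e0 n.+1) (U'^T *m e0 n.+1) ->
  exists2 W, rotations n W & near_mx eta U (lift0 W *m U').
Proof.
move=> rU rU' eta4 h.
have e1 : sphere n.+1 (e0 n.+1).
  rewrite /sphere /= /dotv big_ord_recl big1 ?addr0 => [|i _].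
    by rewrite !mxE mulr1.
  by rewrite !mxE mulr0.
have [||| P [rP PE PT]] := @rotation_to n.+1 (U^T *m e0 n.+1) (U'^T *m e0 n.+1).
- exact/sphere_rotation/e1/rotationsT.
- exact/sphere_rotation/e1/rotationsT.
(* By [eta < 4] and [h] the two points are not antipodal. *)
- by apply: lt_le_trans h; lra.
have rH : rotations n.+1 (U *m P^T *m U'^T).
  by apply: rotationsM; [apply: rotationsM => //|]; exact: rotationsT.
have [|W rW WE] := rotations_fix_e0 rH.
  by rewrite -mulmxA -PE -mulmxA (mulmxA P^T) rotationsTl// mul1mx mulmxA rU.1
    mul1mx.
(* With this [W], the matrix [U^T *m (lift0 W *m U')] is just [P^T], whose trace is known from
   [PT]. *)
exists W => //; rewrite -WE /near_mx -!mulmxA rotationsTl// mulmx1.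
by rewrite !mulmxA rotationsTl// mul1mx mxtrace_tr PT; lra.
Qed.

End Rotations.

(** * Euler angles *)

Section EulerAngles.
Variable R : realType.

(** Off the indices [k] and [k.+1] both factors are the identity; on them the entries are the
    addition formulas. *)
Lemma plane_rotationD n k (a b : R) : (k < n)%N ->
  plane_rotation n k (a + b) = plane_rotation n k a *m plane_rotation n k b.
Proof.
move=> kn; have kn1 : (k < n.+1)%N by rewrite ltnW.
pose i0 : 'I_n.+1 := Ordinal kn1.
pose i1 : 'I_n.+1 := @Ordinal n.+1 k.+1 kn.
have i10 : i1 != i0 by rewrite -val_eqE /= eqn_leq ltnn.
apply/matrixP => i j; rewrite [RHS]mxE (bigD1 i0)//= (bigD1 i1)//=.
rewrite (eq_bigr (fun l => (i == l)%:R * (l == j)%:R)); last first.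
  move=> l /andP[l0 l1]; rewrite !mxE.
  have -> : (l == k :> nat) = false by apply/negbTE;
    rewrite -(val_eqE l i0) in l0.
  have -> : (l == k.+1 :> nat) = false.
    by apply/negbTE; rewrite -(val_eqE l i1) in l1.
  by rewrite !(andbF, andFb).
rewrite !mxE /= !eqxx /= !(eqn_leq k.+1 k) ltnn /= !(eqn_leq k k.+1) ltnn andbF
  /=.
have E0 (l : 'I_n.+1) : (l == i0) = (l == k :> nat) by rewrite -val_eqE.
have E1 (l : 'I_n.+1) : (l == i1) = (l == k.+1 :> nat) by rewrite -val_eqE.
have F0 (l : 'I_n.+1) : (i0 == l) = (l == k :> nat) by rewrite eq_sym E0.
have F1 (l : 'I_n.+1) : (i1 == l) = (l == k.+1 :> nat) by rewrite eq_sym E1.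
rewrite E0 E1 F0 F1 !andbT.
have S0 : (i == k :> nat) || (i == k.+1 :> nat) ->
    \sum_(l | (l != i0) && (l != i1)) (i == l)%:R * (l == j)%:R = 0 :> R.
  move=> H; apply: big1 => l; rewrite E0 E1 => /andP[/negbTE l0 /negbTE l1].
  case: eqP => [il|]; rewrite ?mul0r//.
  by move: H; rewrite il l0 l1.
have kk : (k == k.+1) = false by apply/negbTE; rewrite eqn_leq ltnn andbF.
have kk' : (k.+1 == k) = false by rewrite eq_sym.
have ijF : ((i : nat) != j) -> (i == j) = false by move/negbTE;
  rewrite -val_eqE.
case: (eqVneq (i : nat) k) => [ik|ik].
  rewrite S0 ?ik ?eqxx// kk andbF /=.
  case: (eqVneq (j : nat) k) => [jk|jk]; first by rewrite jk kk cosD /=; ring.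
  case: (eqVneq (j : nat) k.+1) => [jk'|jk']; first by rewrite sinD /=; ring.
  by rewrite ijF ?ik 1?eq_sym//=; ring.
case: (eqVneq (i : nat) k.+1) => [ik'|ik'].
  rewrite S0 ?ik' ?eqxx ?orbT//=.
  case: (eqVneq (j : nat) k) => [jk|jk] /=; first by rewrite jk kk sinD /=;
    ring.
  case: (eqVneq (j : nat) k.+1) => [jk'|jk'] /=; first by rewrite cosD; ring.
  by rewrite ijF ?ik' 1?eq_sym//=; ring.
rewrite /= !mul0r !add0r (bigD1 i) /= ?E0 ?E1 ?ik ?ik'// eqxx mul1r big1
  ?addr0//.
by move=> l /andP[_ /negbTE]; rewrite eq_sym => ->; rewrite mul0r.
Qed.

Lemma plane_rotation0 n k : plane_rotation n k 0 = 1%:M :> 'M[R]_n.+1.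
Proof.
apply/matrixP => i j; rewrite !mxE sin0 cos0 oppr0 -!val_eqE /=.
have [ik|ik] := eqVneq (i : nat) k; have [jk|jk] := eqVneq (j : nat) k => /=;
have [ik'|ik'] := eqVneq (i : nat) k.+1;
have [jk'|jk'] := eqVneq (j : nat) k.+1 => //=; case: eqVneq => //; lia.
Qed.

Lemma plane_rotationT n k (a : R) :
  (plane_rotation n k a)^T = plane_rotation n k (- a).
Proof.
apply/matrixP => i j; rewrite !mxE sinN cosN opprK -!val_eqE /=.
have [ik|ik] := eqVneq (i : nat) k; have [jk|jk] := eqVneq (j : nat) k => /=;
have [ik'|ik'] := eqVneq (i : nat) k.+1;
have [jk'|jk'] := eqVneq (j : nat) k.+1 => //=;
by rewrite eq_sym.
Qed.

(* The determinant is a square, by halving the angle. *)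
Lemma rotations_plane n k (a : R) : (k < n)%N ->
  rotations n (plane_rotation n k a).
Proof.
move=> kn.
have orth (b : R) : plane_rotation n k b *m (plane_rotation n k b)^T = 1%:M.
  by rewrite plane_rotationT -plane_rotationD// subrr plane_rotation0.
split=> //; rewrite (splitr a) plane_rotationD// det_mulmx.
by rewrite -{2}det_tr -det_mulmx orth det1.
Qed.

Lemma lift0_plane n k (a : R) :
  lift0 (plane_rotation n k a) = plane_rotation n.+1 k.+1 a.
Proof.
rewrite /lift0 /lift0_mx -[RHS](@submxK _ 1 n.+1 1 n.+1).
congr (@block_mx _ 1 n.+1 1 n.+1 _ _ _ _); apply/matrixP => i j.
- by rewrite !ord1 !mxE.
- by rewrite !ord1 !mxE.
- by rewrite !ord1 !mxE /= !andbF.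
- by rewrite !mxE -!val_eqE /= !add1n !eqSS.
Qed.

Lemma rotations_Upsilon n J (t : 'rV[R]_J) : (J <= n)%N ->
  rotations n (Upsilon n t).
Proof.
move=> Jn; apply: (big_ind (rotations n)).
- exact: rotations1.
- exact: rotationsM.
- move=> k _; apply: rotations_plane.
  by rewrite -{2}(subnK Jn) ltn_add2l.
Qed.

Lemma lift0_Upsilon n J (t : 'rV[R]_J) : (J <= n)%N ->
  lift0 (Upsilon n t) = Upsilon n.+1 t.
Proof.
move=> Jn; rewrite /Upsilon (big_morph (@lift0 R n) (@lift0M R n) (@lift01 R
  n)).
by apply: eq_bigr => k _; rewrite lift0_plane subSn.
Qed.

(* The signs by which the preimage of e0 under Upsilon^J differs from the point
   with spherical coordinates t. *)
Definition altsign J : 'M[R]_J.+1 := diag_mx (\row_i (-1) ^+ i).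

Lemma altsignT J : (altsign J)^T = altsign J.
Proof. exact: tr_diag_mx. Qed.

Lemma altsignK J : altsign J *m altsign J = 1%:M.
Proof.
rewrite /altsign mulmx_diag -diag_const_mx; congr diag_mx.
by apply/rowP => i; rewrite !mxE -exprMn mulrNN mulr1 expr1n.
Qed.

(** Transposed, the left side is the first row of a product of plane rotations, computed factor by
    factor from the left. The entries [- sin] above the diagonal produce the alternating signs. *)
Lemma Upsilon_e0 J (t : 'rV[R]_J) :
  (Upsilon J t)^T *m e0 R J = altsign J *m sphere_point t.
Proof.
(* The coordinates are extended by 0 to all of [nat], so that products can range over intervals of
   [nat]. *)
pose s k := nth 0 [seq t 0 i | i <- enum 'I_J] k.
have sE (k : 'I_J) : s k = t 0 k.
  by rewrite /s (nth_map k) ?size_enum_ord// nth_ord_enum.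
(* The first row after [m] factors: the entry [m] still lacks its cosine, and those beyond [m]
   vanish. *)
pose r m : 'rV[R]_J.+1 := \row_i
  if (i <= m)%N then (-1) ^+ i * (\prod_(0 <= k < i) sin (s k)) *
    (if (i < m)%N then cos (s i) else 1) else 0.
have rP m : (m <= J)%N ->
    (e0 R J)^T *m (\prod_(0 <= k < m) plane_rotation J k (s k)) = r m.
  elim: m => [|m IH] mJ.
    rewrite big_nil mulmx1; apply/rowP => i; rewrite !mxE leqn0 ltn0.
    have -> : (i == 0 :> nat) = (i == 0) by [].
    by case: eqP => [->|_]; rewrite ?big_geq//= ?expr0 ?mulr1.
  rewrite big_nat_recr; last by [].
  have -> (A B : 'M[R]_J.+1) : (e0 R J)^T *m (A * B) = (e0 R J)^T *m A *m B.
    exact: mulmxA.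
  rewrite (IH (ltnW mJ)).
  have mJ1 : (m < J.+1)%N by rewrite ltnW.
  pose i0 : 'I_J.+1 := Ordinal mJ1.
  pose i1 : 'I_J.+1 := @Ordinal J.+1 m.+1 mJ.
  have rE (i : 'I_J.+1) : (i < m)%N || (i > m.+1)%N -> r m.+1 0 i = r m 0 i.
    rewrite !mxE => /orP[im|im].
      by rewrite im (ltnW im) (leq_trans im)// leqW// ltnW.
    have -> : (i <= m.+1)%N = false by lia.
    by have -> : (i <= m)%N = false by lia.
  have r1 : r m 0 i1 = 0 by rewrite !mxE /= ltnn.
  apply/rowP => j; rewrite mxE (bigD1 i0)//= (bigD1 i1)//=; last first.
    by rewrite -val_eqE /= eqn_leq ltnn.
  rewrite r1 mul0r add0r.
  rewrite (eq_bigr (fun l => (r m 0 l) * (l == j)%:R)); last first.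
    move=> l /andP[l0 l1]; rewrite [plane_rotation _ _ _ _ _]mxE.
    have -> : (l == m :> nat) = false by apply/negbTE;
      rewrite -(val_eqE l i0) in l0.
    have -> : (l == m.+1 :> nat) = false.
      by apply/negbTE; rewrite -(val_eqE l i1) in l1.
    by rewrite !andFb.
  have S0 : (j == i0) || (j == i1) ->
      \sum_(l | (l != i0) && (l != i1)) r m 0 l * (l == j)%:R = 0 :> R.
    move=> H; apply: big1 => l /andP[/negbTE l0 /negbTE l1].
    by case: eqP => [lj|]; rewrite ?mulr0//; move: H; rewrite -lj l0 l1.
  have [j0|j0] := eqVneq j i0.
    rewrite S0 ?j0 ?eqxx// addr0 !mxE /= eqxx leqnn ltnn leqnSn /=.
    by rewrite mulr1 ltnSn.
  have [j1|j1] := eqVneq j i1.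
    rewrite S0 ?j1 ?eqxx ?orbT// addr0 !mxE /= eqxx !leqnn ltnn /= mulr1.
    rewrite (_ : (m == m.+1) = false); last by apply/negbTE;
      rewrite eqn_leq ltnn andbF.
    rewrite (_ : (m.+1 == m) = false); last by apply/negbTE;
      rewrite eqn_leq ltnn.
    rewrite /= ltnn mulr1 big_nat_recr//= exprS eqxx; ring.
  rewrite (bigD1 j) ?j0 ?j1//= eqxx mulr1 big1 ?addr0; last first.
    by move=> l /andP[_ /negbTE ->]; rewrite mulr0.
  rewrite -(rE j); last first.
    have /= jm : val j != val i0 by rewrite val_eqE.
    have /= jm1 : val j != val i1 by rewrite val_eqE.
    by lia.
  rewrite [plane_rotation _ _ _ _ _]mxE /= eqxx.
  have -> : (j == m :> nat) = false by apply/negbTE;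
    rewrite -(val_eqE j i0) in j0.
  have -> : (j == m.+1 :> nat) = false.
    by apply/negbTE; rewrite -(val_eqE j i1) in j1.
  have -> : (m == m.+1) = false by apply/negbTE; rewrite eqn_leq ltnn andbF.
  by rewrite /= [i0 == j]eq_sym (negbTE j0) mulr0 add0r.
have -> : Upsilon J t = \prod_(0 <= k < J) plane_rotation J k (s k).
  rewrite /Upsilon subnn big_mkord.
  by apply: eq_bigr => k _; rewrite add0n sE.
apply: (can_inj trmxK); rewrite trmx_mul trmxK rP// trmx_mul altsignT.
apply/rowP => i; rewrite mul_mx_diag !mxE -ltnS ltn_ord.
rewrite (mulrC _ ((-1) ^+ i)) -mulrA; congr (_ * (_ * _)).
  rewrite (big_nat_widen _ _ J)//; last by rewrite -ltnS.
  by rewrite big_mkord; apply: eq_bigr => k _; rewrite sE.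
(* For [i = J] there is no cosine, and the corresponding product in [sphere_point] is empty. *)
case: ltnP => iJ.
  by rewrite (big_pred1 (Ordinal iJ)) -?sE// => k; rewrite -val_eqE.
rewrite big1// => k /eqP ki.
by have := ltn_ord k; rewrite ki ltnNge iJ.
Qed.

(** The determinant of [altsign] may be -1, but it enters the conjugate twice. *)
Lemma altsign_rotations J (U : 'M[R]_J.+1) :
  rotations J U -> rotations J (altsign J *m U *m altsign J).
Proof.
move=> rU; split.
  rewrite !trmx_mul altsignT !mulmxA -(mulmxA _ (altsign J) (altsign J))
    altsignK mulmx1.
  by rewrite -(mulmxA _ U U^T) rU.1 mulmx1 altsignK.
by rewrite !det_mulmx rU.2 mulr1 -det_mulmx altsignK det1.
Qed.

End EulerAngles.

(** * Borel sets *)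

Section Borel.

Lemma continuous_mx (R : realType) (T : topologicalType) m n
    (f : T -> 'M[R]_(m, n)) :
  (forall i j, continuous (fun x => f x i j)) -> continuous f.
Proof.
move=> cf x A [P nP PA]; rewrite nbhs_filterE /=.
have nx : \forall y \near x, forall ij : 'I_m * 'I_n, P ij.1 ij.2 (f y ij.1
  ij.2).
  by apply: filter_forall => -[i j]; exact: (cf i j x _ (nP i j)).
by apply: filterS nx => y Py; apply: PA => i j; exact: Py (i, j).
Qed.

Lemma continuous_sumr (R : realType) (T : topologicalType) (I : Type)
    (r : seq I) (f : I -> T -> R) :
  (forall i, continuous (f i)) -> continuous (fun x => \sum_(i <- r) f i x).
Proof.
move=> cf x; rewrite -/(continuous_at x _); elim: r => [|i r IH].
  by under eq_fun do rewrite big_nil; exact: cvg_cst.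
under eq_fun do rewrite big_cons.
by apply: cvgD => //; exact: cf.
Qed.

Lemma continuous_mulmx (R : realType) m n p (U : 'M[R]_(m, n)) :
  continuous (fun x : 'M[R]_(n, p) => U *m x).
Proof.
apply: continuous_mx => i j; under eq_fun do rewrite mxE.
apply: continuous_sumr => k x; apply: continuousM; first exact: cst_continuous.
exact: coord_continuous.
Qed.

Lemma continuous_borel (T U : ptopologicalType) (f : T -> U) :
  continuous f -> @measurable_fun _ _ (borel T) (borel U) setT f.
Proof.
move=> cf; apply: (@measurability _ _ (borel T) (borel U) setT f open) => //.
move=> _ [A oA <-]; rewrite setTI; apply: sub_sigma_algebra.
by move/continuousP: cf; exact.
Qed.

Lemma open_borel (T : ptopologicalType) (A : set T) :
  open A -> measurable (A : set (borel T)).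
Proof. exact: sub_sigma_algebra. Qed.

Lemma closed_borel (T : ptopologicalType) (A : set T) :
  closed A -> measurable (A : set (borel T)).
Proof.
move=> cA; rewrite -[A]setCK; apply: measurableC; apply: open_borel.
exact: closed_openC.
Qed.

Variable R : realType.

Lemma continuous_dotv n : continuous (fun x : 'cV[R]_n => dotv x x).
Proof. by apply: continuous_sumr => i x; apply: continuousM;
  exact: coord_continuous. Qed.

Lemma closed_sphere n : closed (@sphere R n).
Proof.
rewrite [X in closed X](_ : _ = (fun x => dotv x x) @^-1` [set 1])//.
by apply: closed_comp => [x _|]; [exact: continuous_dotv|exact: closed_eq].
Qed.

Lemma measurable_sphere n : measurable (sphere n : set (borel 'cV[R]_n.+1)).
Proof. by apply: closed_borel; exact: closed_sphere. Qed.

Lemma measurable_preimage_mulmx n (U : 'M[R]_n)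
    (A : set (borel 'cV[R]_n)) :
  measurable A -> measurable (mulmx U @^-1` A : set (borel 'cV[R]_n)).
Proof.
move=> mA; rewrite -[X in measurable X]setTI.
by apply: (continuous_borel (@continuous_mulmx R n n 1 U)).
Qed.

End Borel.

(** * Comparison of grids *)

Section GridSum.
Variable R : realType.
Variable sigma : forall J : nat, vmeasure R J.+1.
Hypothesis hsigma : forall J : nat, (0 < J)%N -> surface_measure (sigma J).

(* The integral of F against the grid measure, but computed in SO(J+1) for a
   grid of level J, so that it can be studied by induction on the level. *)
Fixpoint grid_sum J (g : grid R J) : ('M[R]_J.+1 -> R) -> R :=
  match g in grid _ J return ('M[R]_J.+1 -> R) -> R with
  | GridNil => fun F => F 1%:M
  | GridCons J K D t sub => fun F =>
      \sum_(a < K) fine (sigma J.+1 (D a)) *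
        grid_sum (sub a) (fun W => F (lift0 W *m Upsilon J.+1 (t a)))
  end.

(** The mass shared by all grids of level [J], whatever their partitions. *)
Definition total_mass J : R := \prod_(k < J) Sigma R k.+1.

Lemma Sigma_ge0 J : (0 < J)%N -> 0 <= Sigma R J.
Proof.
by move=> J0; have [_ SJ _] := hsigma J0; rewrite -lee_fin -SJ measure_ge0.
Qed.

Lemma total_mass_ge0 J : 0 <= total_mass J.
Proof. by apply: prodr_ge0 => k _; exact: Sigma_ge0. Qed.

Lemma surface_fin_num J (A : set (borel 'cV[R]_J.+1)) : (0 < J)%N ->
  measurable A -> A `<=` sphere J -> sigma J A \is a fin_num.
Proof.
move=> J0 mA AS; have [_ SJ _] := hsigma J0.
rewrite ge0_fin_numE ?measure_ge0//.
apply: (@le_lt_trans _ _ (sigma J (sphere J))); last by rewrite SJ ltry.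
by apply: le_measure => //; rewrite inE//; exact: measurable_sphere.
Qed.

Lemma partition_measure J K (D : nat -> set (borel 'cV[R]_J.+1))
    (A : set (borel 'cV[R]_J.+1)) : (0 < J)%N ->
  partition `I_K D (sphere J) -> (forall a, (a < K)%N -> measurable (D a)) ->
  measurable A -> A `<=` sphere J ->
  fine (sigma J A) = \sum_(a < K) fine (sigma J (A `&` D a)).
Proof.
move=> J0 [cD tD _] mD mA AS.
have AE : A = \bigcup_(a in `I_K) (A `&` D a).
  by rewrite -setI_bigcupr; apply/esym/setIidPl; rewrite -/(cover _ _) cD.
rewrite {1}AE (measure_fin_bigcup _ (finite_II K)); first last.
- by move=> a aK; apply: measurableI => //; exact: mD.
- exact: trivIset_setIl.
rewrite -fsbig_ord -sum_fine// => a _.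
by apply: surface_fin_num => //; [apply: measurableI => //; exact: mD|
  apply: subIset; left].
Qed.

Lemma partition_total J K (D : nat -> set (borel 'cV[R]_J.+1)) : (0 < J)%N ->
  partition `I_K D (sphere J) -> (forall a, (a < K)%N -> measurable (D a)) ->
  \sum_(a < K) fine (sigma J (D a)) = Sigma R J.
Proof.
move=> J0 pD mD; have [_ SJ _] := hsigma J0.
rewrite -[RHS]/(fine (Sigma R J)%:E) -SJ (partition_measure J0 pD mD)//.
  apply: eq_bigr => a _; congr (fine (sigma J _)); apply/esym/setIidPr.
  by case: pD => <- _ _; apply: bigcup_sup; exact: ltn_ord.
exact: measurable_sphere.
Qed.

(** Inversion of the indexed type [grid], so that two grids of the same level can be taken apart
    together. *)
Lemma grid_inv J (g : grid R J) :
  match J return grid R J -> Prop with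
  | 0 => fun g => g = GridNil R
  | J.+1 => fun g => exists K D t sub, g = GridCons K D t sub
  end g.
Proof. by case: g => // J' K D t sub; exists K, D, t, sub. Qed.

(** [grid_sum g] is a combination of values at rotations, with nonnegative weights of sum
    [total_mass J]. *)
Lemma grid_sum_le J (g : grid R J) delta (F G : 'M[R]_J.+1 -> R) (eps : R) :
  grid_of_type sigma delta g -> 0 <= eps ->
  (forall U, rotations J U -> `|F U - G U| <= eps) ->
  `|grid_sum g F - grid_sum g G| <= eps * total_mass J.
Proof.
move=> + eps0; elim: g F G => [|{}J K D t sub IH] F G.
  rewrite /total_mass big_ord0 mulr1 => _; apply; exact: rotations1.
move=> [pD gD] FG /=; rewrite -sumrB.
have mD a : (a < K)%N -> measurable (D a) by move=> /gD[].
apply: (le_trans (ler_norm_sum _ _ _)).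
apply: (@le_trans _ _ (\sum_(a < K) fine (sigma J.+1 (D a)) *
    (eps * total_mass J))).
  apply: ler_sum => a _; rewrite -mulrBr normrM ger0_norm ?fine_ge0//.
  apply: ler_wpM2l; first exact: fine_ge0.
  have [_ _ _ _ ga] := gD a (ltn_ord a).
  apply: IH => // U rU; apply: FG; apply: rotationsM.
    exact/rotations_lift0.
  exact: rotations_Upsilon.
rewrite -mulr_suml partition_total// /total_mass big_ord_recr /= mulrA mulrC.
by rewrite mulrA.
Qed.

(** Two points of one cell then have scalar product at least [1 - eta / 8]; passing through two
    cells costs 4 times as much by [dotv_triangle], which is the [eta / 2] required by
    [coset_near]. *)
Definition radius (eta : R) : R := acos (1 - eta / 8).

Lemma radius_gt0 eta : 0 < eta <= 2 -> 0 < radius eta.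
Proof. by move=> eta2; apply: acos_gt0; lra. Qed.

Lemma geodist_radius J eta (x y : 'cV[R]_J.+1) : 0 < eta <= 2 ->
  sphere J x -> sphere J y -> geodist x y <= radius eta ->
  1 - eta / 8 <= dotv x y.
Proof.
move=> eta2 x1 y1; have xy := dotv_sphere_le1 x1 y1.
have eta1 : -1 <= 1 - eta / 8 <= 1 by lra.
rewrite /geodist /radius => h; rewrite leNgt; apply/negP => lt.
have : acos (1 - eta / 8) < acos (dotv x y); last by rewrite ltNge h.
rewrite -ltr_cos ?acosK ?in_itv//= ?acos_ge0 ?acos_lepi//.
Qed.

(* The common refinement of the partitions of g and of the rotated partitions of
   g' compares the two sums cell by cell. *)
Lemma grid_sum_near J (g g' : grid R J) (eta eps : R)
    (F : 'M[R]_J.+1 -> R) (h : 'M[R]_J.+1)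
    (delta := fun _ : nat => radius eta) :
  0 < eta <= 2 -> 0 <= eps ->
  grid_of_type sigma delta g -> grid_of_type sigma delta g' ->
  rotations J h ->
  (forall U U', rotations J U -> rotations J U' -> near_mx eta U U' ->
    `|F U - F U'| <= eps) ->
  `|grid_sum g (fun W => F (W *m h)) - grid_sum g' F| <=
    J%:R * eps * total_mass J.
Proof.
move=> eta2 eps0.
elim: J g g' F h => [|J IH] g g' F h.
  rewrite (grid_inv g) (grid_inv g') /= => _ _ [_ dh] _.
  (* SO(1) is trivial. *)
  have -> : h = 1%:M by apply/matrixP => i j; rewrite !ord1 -dh det_mx11 mxE.
  by rewrite mulmx1 subrr normr0 !mul0r.
have [K [D [t [sub ->]]]] := grid_inv g.
have [K' [D' [t' [sub' ->]]]] := grid_inv g'.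
move=> [pD gD] [pD' gD'] rh Fnear /=.
have mD a : (a < K)%N -> measurable (D a) by move=> /gD[].
have mD' a : (a < K')%N -> measurable (D' a) by move=> /gD'[].
have DS a : (a < K)%N -> D a `<=` sphere J.+1.
  by case: pD => <- _ _ aK; exact: (@bigcup_sup _ _ a `I_K).
have DS' a : (a < K')%N -> D' a `<=` sphere J.+1.
  by case: pD' => <- _ _ aK; exact: (@bigcup_sup _ _ a `I_K').
(* For [x] and [y] the chosen points of [D a] and [D' b], [Upsilon_e0] sends [e0] to [h^T *m A *m x]
   and to [A *m y]. Their scalar product is that of [T *m x] and [y], so the cells of [g'] are
   pulled back by [T]. *)
set A := altsign R J.+1.
pose T := A *m h^T *m A.
have rT : rotations J.+1 T by apply: altsign_rotations; exact: rotationsT.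
have [_ _ sinv] := @hsigma J.+1 isT.
pose TD' b : set (borel 'cV[R]_J.+2) := mulmx T @^-1` D' b.
have mTD' b : (b < K')%N -> measurable (TD' b).
  by move=> bK; apply: measurable_preimage_mulmx; exact: mD'.
have TDS' b : (b < K')%N -> TD' b `<=` sphere J.+1.
  move=> bK x /(DS' _ bK) /(sphere_rotation (rotationsT rT)).
  by rewrite mulmxA rotationsTl// mul1mx.
have pTD' : partition `I_K' TD' (sphere J.+1).
  case: pD' => cD' tD' nD'; split.
  - apply/seteqP; split => [x [b bK]|x xS]; first exact: TDS'.
    have : cover `I_K' D' (T *m x) by rewrite cD'; exact: sphere_rotation.
    by move=> [b bK Dx]; exists b.
  - move=> b c bK cK [x [Dx Dx']]; apply: (tD' _ _ bK cK).
    by exists (T *m x).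
  - move=> b bK; have [x Dx] := nD' b bK; exists (T^T *m x).
    by rewrite /TD' /= mulmxA rT.1 mul1mx.
(* The masses of the common refinement. Summed over [b] they give the weights of [g]; summed over
   [a] those of [g'], by invariance under [T]. *)
pose mu a b := fine (sigma J.+1 (D a `&` TD' b)).
have sD a : (a < K)%N -> fine (sigma J.+1 (D a)) = \sum_(b < K') mu a b.
  move=> aK; apply: partition_measure => //; [exact: mD|exact: DS].
have sD' b : (b < K')%N -> fine (sigma J.+1 (D' b)) = \sum_(a < K) mu a b.
  move=> bK; rewrite -(sinv T (D' b) rT (mD' _ bK)).
  rewrite (partition_measure _ pD)//; [|exact: mTD'|exact: TDS'].
  by apply: eq_bigr => a _; rewrite setIC.
rewrite (eq_bigr (fun a : 'I_K => \sum_(b < K') mu a b *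
    grid_sum (sub a) (fun W => F (lift0 W *m Upsilon J.+1 (t a) *m h))));
  last by move=> a _; rewrite sD// mulr_suml.
rewrite [X in _ - X](eq_bigr (fun b : 'I_K' => \sum_(a < K) mu a b *
    grid_sum (sub' b) (fun W => F (lift0 W *m Upsilon J.+1 (t' b)))));
  last by move=> b _; rewrite sD'// mulr_suml.
rewrite [X in _ - X]exchange_big /= -sumrB.
(* The error allowed per unit of mass on the sphere of level [J.+1]; the [mu a b] add up to
   [Sigma R J.+1]. *)
pose C := J.+1%:R * eps * total_mass J.
have C0 : 0 <= C by rewrite !mulr_ge0// total_mass_ge0.
apply: (le_trans (ler_norm_sum _ _ _)).
apply: (@le_trans _ _ (\sum_(a < K) \sum_(b < K') mu a b * C)); last first.
  under eq_bigr => a _ do rewrite -mulr_suml -sD//.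
  rewrite -mulr_suml partition_total// /C /total_mass [X in _ <= _ *
    X]big_ord_recr /=.
  by rewrite mulrC !mulrA.
apply: ler_sum => a _; rewrite -sumrB; apply: (le_trans (ler_norm_sum _ _ _)).
apply: ler_sum => b _; rewrite -mulrBr normrM ger0_norm ?fine_ge0//.
(* Cells that do not meet have weight 0; otherwise a common point [z] links [T *m x] to [y]. *)
rewrite /mu; have [->|] := eqVneq (D a `&` TD' b) set0.
  by rewrite measure0 !mul0r.
move=> /set0P[z [Dz Dz']].
apply: ler_wpM2l; first exact: fine_ge0.
have aK := ltn_ord a; have bK := ltn_ord b.
have [_ _ diamD [st Dt] ga] := gD a aK.
have [_ _ diamD' [st' Dt'] gb] := gD' b bK.
set x := sphere_point (t a) in Dt; set y := sphere_point (t' b) in Dt'.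
have rU : rotations J.+1 (Upsilon J.+1 (t a)) by exact: rotations_Upsilon.
have rU' : rotations J.+1 (Upsilon J.+1 (t' b)) by exact: rotations_Upsilon.
have [||||W rW nW] := @coset_near R J eta (Upsilon J.+1 (t a) *m h)
    (Upsilon J.+1 (t' b)).
- exact: rotationsM.
- by [].
- by lra.
- rewrite trmx_mul -mulmxA !Upsilon_e0 -/A -/x -/y.
  have -> : dotv (h^T *m (A *m x)) (A *m y) = dotv (T *m x) y.
    by rewrite /T -!mulmxA [RHS]dotv_mul altsignT.
  (* Here [x] and [z] lie in [D a], while [T *m z] and [y] lie in [D' b]. *)
  have := @dotv_triangle R J.+1 (T *m x) (T *m z) y (eta / 8).
  have xS := DS a aK _ Dt; have yS := DS' b bK _ Dt'; have zS := DS a aK _ Dz.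
  rewrite dotv_orth ?rotationsTl// => /(_ (sphere_rotation rT xS)
    (sphere_rotation rT zS) yS).
  rewrite (_ : 4 * (eta / 8) = eta / 2); last by field.
  apply; apply: geodist_radius => //; [exact: diamD| |exact: diamD'].
  exact: sphere_rotation.
(* The intermediate sum keeps the grid [sub a] but replaces [Upsilon J.+1 (t a) *m h] by the nearby
   [lift0 W *m Upsilon J.+1 (t' b)], at the cost of one [eps]. The induction hypothesis, with [W]
   for [h], then removes [W] and changes the grid. *)
rewrite -(subrKA (grid_sum (sub a)
   (fun V => F (lift0 (V *m W) *m Upsilon J.+1 (t' b))))).
apply: (le_trans (ler_normD _ _)).
rewrite /C -natr1 mulrDl mul1r mulrDl addrC; apply: lerD.
  apply: (IH (sub a) (sub' b)
    (fun V => F (lift0 V *m Upsilon J.+1 (t' b))) W) => //.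
  move=> V V' rV rV' VV'; apply: Fnear; [| |].
  - by apply: rotationsM => //; exact/rotations_lift0.
  - by apply: rotationsM => //; exact/rotations_lift0.
  - by apply/near_mxMr => //; exact/near_mx_lift0.
apply: (grid_sum_le ga eps0) => V rV.
have rV0 : rotations J.+1 (lift0 V) by exact/rotations_lift0.
have rW0 : rotations J.+1 (lift0 W) by exact/rotations_lift0.
apply: Fnear; rewrite -?mulmxA ?lift0M.
- by apply: rotationsM => //; exact: rotationsM.
- by do 2!apply: rotationsM => //.
- by rewrite -mulmxA; exact/near_mxMl.
Qed.

End GridSum.

(** * Grid measures and the invariant measure *)

Section GridMeasure.
Variable R : realType.
Variable sigma : forall J : nat, vmeasure R J.+1.
Hypothesis hsigma : forall J : nat, (0 < J)%N -> surface_measure (sigma J).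

Lemma measurable_grid_set n J (g : grid R J) (V : 'M[R]_n.+1) :
  measurable (grid_set g V).
Proof.
elim: g V => [|{}J K D t sub IH] V /=.
  apply: closed_borel; apply: accessible_closed_set1.
  by apply: hausdorff_accessible; exact: norm_hausdorff.
by apply: fin_bigcup_measurable => [|a _]; [exact: finite_II|exact: IH].
Qed.

Lemma grid_set_rotations n J (g : grid R J) (V : 'M[R]_n.+1) : (J <= n)%N ->
  rotations n V -> grid_set g V `<=` rotations n.
Proof.
elim: g V => [|{}J K D t sub IH] V Jn rV /=; first by move=> _ ->.
move=> U [a _ /IH]; apply; first exact: ltnW.
by apply: rotationsM => //; exact: rotations_Upsilon.
Qed.

(** [grid_sum] works in SO(J+1) and [grid_measure] in SO(n+1). In the induction [emb] is composed
    with [lift0] at each lower level, and [V] collects the factors already chosen. *)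
Lemma integral_grid_measure n J (g : grid R J) (emb : 'M[R]_J.+1 -> 'M[R]_n.+1)
    (V : 'M[R]_n.+1) (E : set (borel 'M[R]_n.+1)) (f : borel 'M[R]_n.+1 -> R) :
  {morph emb : A B / A *m B} -> emb 1%:M = 1%:M ->
  (forall J' (t : 'rV[R]_J'), (J' <= J)%N -> emb (Upsilon J t) = Upsilon n t) ->
  measurable E -> grid_set g V `<=` E -> measurable_fun E f ->
  (forall U, E U -> 0 <= f U) ->
  (\int[grid_measure sigma g V]_(U in E) (f U)%:E)%E =
  (grid_sum sigma g (fun W => f (emb W *m V)))%:E.
Proof.
move=> + + + mE + mf f0.
elim: g emb V => [|{}J K D t sub IH] emb V embM emb1 embU gE.
  rewrite /= integral_dirac//; last exact/measurable_EFinP.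
  by rewrite diracE mem_set ?mul1e ?emb1 ?mul1mx//; apply: gE.
rewrite /= ge0_integral_measure_sum//; last exact/measurable_EFinP.
rewrite -sumEFin; apply: eq_bigr => a _.
rewrite ge0_integral_mscale//; last exact/measurable_EFinP.
rewrite (IH a (emb \o @lift0 R J)) /=.
- rewrite EFinM; congr (_ * (grid_sum _ _ _)%:E)%E; apply/funext => W.
  by rewrite embM embU// mulmxA.
- by move=> A B; rewrite [LHS]/= lift0M embM.
- by rewrite lift01.
- by move=> J' t' J'J; rewrite lift0_Upsilon// embU// ltnW.
- move=> U gU; apply: gE; exists (nat_of_ord a); [exact: ltn_ord|exact: gU].
Qed.

Variables (n : nat) (nu : mxmeasure R n).
Hypothesis hnu : invariant_unit_measure nu.

Local Notation SO := (rotations n : set (borel 'M[R]_n.+1)).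
Hypothesis mrot : measurable SO.

Lemma measurable_fun_mulmxl (U : 'M[R]_n.+1) (f : borel 'M[R]_n.+1 -> R) :
  rotations n U -> measurable_fun SO f ->
  measurable_fun SO (fun V => f (U *m V)).
Proof.
move=> rU mf.
apply: (@measurable_comp _ _ _ _ _ _ SO f
  SO (mulmx U : borel _ -> borel _)) => //.
  by move=> _ [V rV <-]; exact: rotationsM.
apply: (@measurable_funS _ _ (borel 'M[R]_n.+1) (borel 'M[R]_n.+1) setT) => //.
exact: (continuous_borel (@continuous_mulmx R n.+1 n.+1 n.+1 U)).
Qed.

Lemma integral_mulmxl (U : 'M[R]_n.+1) (f : borel 'M[R]_n.+1 -> R) :
  rotations n U -> measurable_fun SO f ->
  (forall V, rotations n V -> 0 <= f V) ->
  (\int[nu]_(V in rotations n) (f (U *m V))%:E =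
   \int[nu]_(V in rotations n) (f V)%:E)%E.
Proof.
move=> rU mf f0; have [_ _ ninv] := hnu.
pose phi : borel 'M[R]_n.+1 -> borel 'M[R]_n.+1 := mulmx U.
have mphi : measurable_fun setT phi.
  exact: (continuous_borel (@continuous_mulmx R n.+1 n.+1 n.+1 U)).
transitivity (\int[pushforward nu phi]_(V in rotations n) (f V)%:E)%E;
  last first.
  by apply: eq_measure_integral => A mA _; have [+ _] := ninv U A rU mA.
rewrite (ge0_integral_pushforward mphi)//; first last.
- by move=> V /set_mem rV; rewrite lee_fin; exact: f0.
- exact/measurable_EFinP.
congr (integral nu _ _); apply/seteqP; split=> V /=; first exact: rotationsM.
by move=> /(rotationsM (rotationsT rU)); rewrite mulmxA rotationsTl// mul1mx.
Qed.

(** Left invariance of [nu] gives every term of the sum the same integral, and the weights add up to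
    [total_mass]. Nonnegativity and measurability are carried along to integrate the sum of the next
    level termwise. *)
Lemma grid_sum_average J (g : grid R J) delta (e : 'M[R]_J.+1 -> 'M[R]_n.+1)
    (f : borel 'M[R]_n.+1 -> R) :
  grid_of_type sigma delta g ->
  (forall W, rotations J W -> rotations n (e W)) ->
  measurable_fun SO f -> (forall V, rotations n V -> 0 <= f V) ->
  [/\ forall V, rotations n V -> 0 <= grid_sum sigma g (fun W => f (e W *m V)),
   measurable_fun SO
    (fun V => grid_sum sigma g (fun W => f (e W *m V))) &
  (\int[nu]_(V in rotations n) (grid_sum sigma g (fun W => f (e W *m V)))%:E =
   (total_mass R J)%:E * \int[nu]_(V in rotations n) (f V)%:E)%E].
Proof.
move=> + + mf f0; elim: g e => [|{}J K D t sub IH] e.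
  move=> _ re; have r1 := re _ (rotations1 R 0); split => /=.
  - by move=> V rV; apply: f0; exact: rotationsM.
  - exact: measurable_fun_mulmxl.
  - by rewrite integral_mulmxl// /total_mass big_ord0 mul1e.
move=> [pD gD] re /=.
have mD a : (a < K)%N -> measurable (D a) by move=> /gD[].
have H (a : 'I_K) := IH a (fun W => e (lift0 W *m Upsilon J.+1 (t a))).
have {}H (a : 'I_K) : [/\ forall V, rotations n V -> 0 <= grid_sum sigma (sub a)
      (fun W => f (e (lift0 W *m Upsilon J.+1 (t a)) *m V)),
    measurable_fun SO
      (fun V => grid_sum sigma (sub a)
        (fun W => f (e (lift0 W *m Upsilon J.+1 (t a)) *m V))) &
    (\int[nu]_(V in rotations n) (grid_sum sigma (sub a)
        (fun W => f (e (lift0 W *m Upsilon J.+1 (t a)) *m V)))%:E =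
      (total_mass R J)%:E * \int[nu]_(V in rotations n) (f V)%:E)%E].
  apply: H; first by have [] := gD a (ltn_ord a).
  move=> W rW; apply: re; apply: rotationsM; first exact/rotations_lift0.
  exact: rotations_Upsilon.
split.
- move=> V rV; apply: sumr_ge0 => a _; rewrite mulr_ge0 ?fine_ge0//.
  by have [+ _ _] := H a; exact.
- apply: measurable_sum => a; apply: measurable_funM => //.
  by have [] := H a.
- under eq_integral do rewrite -sumEFin.
  rewrite ge0_integral_sum//; first last.
  + move=> a V rV; rewrite lee_fin mulr_ge0 ?fine_ge0//.
    by have [+ _ _] := H a; exact.
  + move=> a; apply/measurable_EFinP; apply: measurable_funM => //.
    by have [] := H a.
  transitivity (\sum_(a < K) (fine (sigma J.+1 (D a)))%:E *
      ((total_mass R J)%:E * \int[nu]_(V in rotations n) (f V)%:E))%E.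
    apply: eq_bigr => a _; have [H0 mH <-] := H a.
    under eq_integral do rewrite EFinM.
    rewrite ge0_integralZl ?lee_fin ?fine_ge0//.
    exact/measurable_EFinP.
  rewrite -ge0_sume_distrl; last by move=> a _; rewrite lee_fin fine_ge0.
  rewrite sumEFin (partition_total hsigma _ pD mD)// muleA -EFinM.
  by rewrite /total_mass big_ord_recr /= mulrC.
Qed.

(** The bound between the sums at [V] and at the identity is integrated over [V], [nu] having mass
    1. Two additive inequalities avoid subtracting extended reals. *)
Lemma grid_sum_integral (g : grid R n) (eta eps : R) (f : borel 'M[R]_n.+1 -> R)
    (c := n%:R * eps * total_mass R n) :
  0 < eta <= 2 -> 0 <= eps -> grid_of_type sigma (fun=> radius eta) g ->
  measurable_fun SO f -> (forall V, rotations n V -> 0 <= f V) ->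
  (forall U U', rotations n U -> rotations n U' -> near_mx eta U U' ->
    `|f U - f U'| <= eps) ->
  ((grid_sum sigma g f)%:E <=
     (total_mass R n)%:E * \int[nu]_(V in rotations n) (f V)%:E + c%:E /\
   (total_mass R n)%:E * \int[nu]_(V in rotations n) (f V)%:E <=
     (grid_sum sigma g f)%:E + c%:E)%E.
Proof.
move=> eta2 eps0 gg mf f0 fnear.
have [S0 mS <-] := grid_sum_average gg (fun W rW => rW) mf f0.
(* Both grids are [g] here, and [h] is [V]. *)
have near V (rV : rotations n V) :=
  grid_sum_near hsigma eta2 eps0 gg gg rV fnear.
have c0 : 0 <= c by rewrite !mulr_ge0// (total_mass_ge0 hsigma).
have [_ nu1 _] := hnu.
have s0 : 0 <= grid_sum sigma g f.
  have := S0 1%:M (rotations1 R n).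
  by under eq_fun do rewrite mulmx1.
have int_cst (x : R) : (\int[nu]_(V in rotations n) x%:E = x%:E)%E.
  by rewrite integral_cst// nu1 mule1.
split.
  rewrite -[leLHS]int_cst -[X in (_ + X)%E]int_cst -ge0_integralD//.
  - apply: ge0_le_integral => //.
    + apply: emeasurable_funD => //; exact/measurable_EFinP.
    + move=> V rV; rewrite -EFinD lee_fin.
      by have := near V rV; rewrite distrC ler_norml => /andP[_];
        rewrite lerBlDl.
  - exact/measurable_EFinP.
rewrite -[leRHS]int_cst; apply: ge0_le_integral => //.
- exact/measurable_EFinP.
- move=> V rV; rewrite lee_fin.
  by have := near V rV; rewrite ler_norml => /andP[_]; rewrite lerBlDl.
Qed.

End GridMeasure.

(** * Positivity of the surface measures *)

Section GammaFunction.
Variable R : realType.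

(** With [k = 2 * (p + 1)], write [ln t] as [ln k + ln (t / k)]; then [ln (t / k) <= t / k] and
    [p / k <= 1 / 2]. *)
Lemma powR_le_expR (p t : R) : 0 <= p -> 0 < t ->
  t `^ p <= expR (p * ln (2 * (p + 1))) * expR (t / 2).
Proof.
move=> p0 t0; set k := 2 * (p + 1).
have k0 : 0 < k by rewrite /k; lra.
rewrite /powR gt_eqF// -expRD ler_expR.
rewrite -{1}(divfK (lt0r_neq0 k0) t) lnM ?posrE ?divr_gt0//.
rewrite mulrDr addrC lerD2l.
apply: (@le_trans _ _ (p * (t / k))).
  by rewrite ler_wpM2l// ltW// ln_sublinear// divr_gt0.
rewrite mulrCA ler_wpM2l ?(ltW t0)// -/k ler_pdivrMr// /k; lra.
Qed.

(** The integrand is dominated by a multiple of the exponential density of rate 1/2, and on [1, 2]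
    it is at least [expR (- 2)]. *)
Lemma Gamma_gt0 (s : R) : 1 <= s -> 0 < Gamma s.
Proof.
move=> s1; have p0 : 0 <= s - 1 by lra.
set p := s - 1 in p0; pose f t := t `^ p * expR (- t).
pose D : set R := `]0, +oo[%classic.
have mD : measurable D by exact: measurable_itv.
have mf : measurable_fun setT f.
  apply: measurable_funM; first exact: measurable_powR.
  by apply: measurableT_comp => //; exact: measurable_expR.
have f0 t : 0 <= f t by rewrite mulr_ge0// ?powR_ge0 ?expR_ge0.
have h0 : (0 : R) < 2^-1 by lra.
set C := 2 * expR (p * ln (2 * (p + 1))).
have fD : lebesgue_measure.-integrable D (EFin \o f).
  apply: (@le_integrable _ _ R lebesgue_measure D mD (EFin \o f)
      (fun t => C%:E * (exponential_pdf 2^-1 t)%:E)%E).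
  - by apply/measurable_EFinP; exact: measurable_funTS.
  - move=> t; rewrite /D /= in_itv/= andbT => t0.
    rewrite lee_fin !ger0_norm//; last first.
      by rewrite mulr_ge0 ?exponential_pdf_ge0 ?ltW// mulr_gt0 ?expR_gt0.
    rewrite exponential_pdfE; last exact: ltW.
    rewrite /C /f.
    have -> : - t = - (t / 2) + - 2^-1 * t by field.
    rewrite expRD mulrA [leRHS]mulrA (mulrAC 2) mulfV// mul1r.
    rewrite ler_wpM2r ?expR_ge0// expRN ler_pdivrMr ?expR_gt0//.
    exact: powR_le_expR.
  - apply: integrableZl => //; apply: (@integrableS _ _ _ _ setT) => //.
    exact: integrable_exponential_pdf.
(* [fine] sends an infinite integral to 0, so positivity includes finiteness. *)
rewrite /Gamma -/p /Rintegral -/D fine_gt0//; apply/andP; split; last first.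
  suff /fin_numPlt/andP[] : (\int[lebesgue_measure]_(t in D) (f t)%:E)%E
    \is a fin_num by [].
  exact: integrable_fin_num.
pose E : set R := `[1, 2]%classic.
have mE : measurable E by exact: measurable_itv.
have ED : E `<=` D.
  by move=> t; rewrite /E /D /= !in_itv/= andbT => /andP[t1 _];
    apply: lt_le_trans t1.
apply: (@lt_le_trans _ _ (\int[lebesgue_measure]_(t in E) (f t)%:E)%E);
  last first.
  apply: ge0_subset_integral => //.
    by apply/measurable_EFinP; exact: measurable_funTS.
  by move=> t _; rewrite lee_fin.
apply: (@lt_le_trans _ _ (\int[lebesgue_measure]_(t in E) (expR (- 2))%:E)%E).
  rewrite integral_cst//= lebesgue_measure_itv/= lte_fin ltr1n -EFinB -EFinM
    lte_fin.
  by rewrite mulr_gt0 ?expR_gt0//; lra.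
apply: ge0_le_integral => //.
- by apply/measurable_EFinP; exact: measurable_funTS.
- move=> t; rewrite /E /= in_itv/= lee_fin => /andP[t1 t2].
  rewrite -[leLHS]mul1r ler_pM ?ler_expR ?lerN2//.
  by rewrite -(powRr0 t) ler_powR.
Qed.

Lemma Sigma_gt0 J : (0 < J)%N -> 0 < Sigma R J.
Proof.
move=> J0; rewrite divr_gt0 ?mulr_gt0 ?powR_gt0 ?pi_gt0//.
apply: Gamma_gt0; rewrite ler_pdivlMr// mul1r ler_nat.
by rewrite ltnS.
Qed.

Lemma total_mass_gt0 J : 0 < total_mass R J.
Proof. by apply: prodr_gt0 => k _; exact: Sigma_gt0. Qed.

End GammaFunction.

(** * Uniform continuity on the sphere *)

Section UniformContinuity.
Variables (R : realType) (n : nat).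
Implicit Types g : 'cV[R]_n.+1 -> R.

Lemma compact_sphere : compact (@sphere R n).
Proof.
have ctr p q : continuous (@trmx R p q).
  apply: continuous_mx => i j x; under eq_fun do rewrite mxE.
  exact: coord_continuous.
(* Boundedness and closedness give compactness for row vectors; transposition carries it over. *)
have -> : @sphere R n = trmx @` (trmx @^-1` @sphere R n).
  apply/seteqP; split=> [x xS|_ [y yS <-]//].
  by exists x^T; rewrite /= trmxK.
apply: continuous_compact; first by apply: continuous_subspaceT; exact: ctr.
apply: bounded_closed_compact; last first.
  apply: closed_comp; [by move=> x _; exact: ctr|exact: closed_sphere].
exists 1; split => // M M1 y; rewrite /= /sphere /= => y1.
rewrite [leLHS]mx_normrE; apply: bigmax_le => [|ij _].
  by rewrite ltW// (lt_trans _ M1).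
apply: le_trans (ltW M1).
rewrite -(@expr_le1 _ 2)// real_normK ?num_real// -y1 /dotv.
rewrite (bigD1 ij.2)//= !mxE (ord1 ij.1) expr2 lerDl.
by apply: sumr_ge0 => k _; rewrite -expr2 sqr_ge0.
Qed.

(** Continuity of the restriction to the sphere, since the values of [g] elsewhere are arbitrary. *)
Definition continuous_on_sphere g : Prop :=
  forall x, sphere n x -> forall eps, 0 < eps ->
    \forall y \near x, sphere n y -> `|g x - g y| < eps.

Lemma C1_sphere_continuous (f : sphfun R n) : C1_sphere f ->
  continuous_on_sphere (fun x => complex.Re (f x)) /\
  continuous_on_sphere (fun x => complex.Im (f x)).
Proof.
move=> f1.
have H (F : 'cV[R]_n.+1 -> R) (W : set 'cV[R]_n.+1) h x : open W -> W x ->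
    differentiable F x -> (forall y, W y -> sphere n y -> h y = F y) ->
    sphere n x -> forall eps, 0 < eps ->
    \forall y \near x, sphere n y -> `|h x - h y| < eps.
  move=> oW Wx dF hF xS eps eps0.
  have /cvgrPdist_lt/(_ _ eps0) := differentiable_continuous dF.
  apply: filterS2 (open_nbhs_nbhs (conj oW Wx)) => y Wy Fy yS.
  by rewrite !hF.
split=> x xS; have [W [F [G [oW Wx [dF _] [dG _] fE]]]] := f1 x xS.
  by apply: (H F W) => //; [exact: dF|move=> y Wy yS; rewrite fE].
by apply: (H G W) => //; [exact: dG|move=> y Wy yS; rewrite fE].
Qed.

(** The Heine-Cantor argument, with compactness in its near-covering form along the filter of small
    positive [d]. *)
Lemma continuous_on_sphere_uniform g eps : continuous_on_sphere g -> 0 < eps ->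
  exists2 d : R, 0 < d & forall x y, sphere n x -> sphere n y ->
    ball x d y -> `|g x - g y| < eps.
Proof.
move=> gc eps0.
have eps2 : 0 < eps / 2 by rewrite divr_gt0.
have /compact_near_coveringP K := compact_sphere.
have := K R (0^'+) (fun d x => sphere n x -> forall y, sphere n y ->
  ball x d y -> `|g x - g y| < eps) _.
case=> [x xS|e /= e0 He].
  have /nbhs_ballP[e /= e0 He] := gc x xS _ eps2.
  exists (ball x (e / 2), [set d | d < e / 2]) => /=.
    split; first by apply: nbhsx_ballx; rewrite divr_gt0.
    by apply: nbhs_right_lt; rewrite divr_gt0.
  move=> [x' d] /= [xx' de] xS' y yS x'y.
  have xx'e : ball x e x' by apply: le_ball xx'; rewrite ler_pdivrMr//; lra.
  have xye : ball x e y.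
    rewrite (splitr e); apply: ball_triangle xx' _.
    by apply: le_ball x'y; exact: ltW.
  have h1 := He _ xx'e xS'; have h2 := He _ xye yS.
  rewrite (splitr eps) -(subrKA (g x)); apply: le_lt_trans (ler_normD _ _) _.
  by rewrite ltrD// distrC.
exists (e / 2); first by rewrite divr_gt0.
move=> x y xS yS; apply: (He (e / 2)) => //; last by rewrite /= divr_gt0.
by rewrite /= sub0r normrN ger0_norm ?divr_ge0 ?ltW// ltr_pdivrMr//; lra.
Qed.

Lemma continuous_on_sphere_bounded g : continuous_on_sphere g ->
  exists b : R, forall x, sphere n x -> `|g x| <= b.
Proof.
move=> gc; have /compact_near_coveringP K := compact_sphere.
have := K R +oo%R (fun b x => sphere n x -> `|g x| <= b) _.
case=> [x xS|b [_ /(_ (b + 1))]]; last first.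
  by move=> H; exists (b + 1) => x xS; apply: H; rewrite ?ltrDl.
have near1 := gc x xS 1 ltr01.
exists ([set y | sphere n y -> `|g x - g y| < 1], [set b | `|g x| + 1 < b]) =>
  /=.
  by split => //; apply: nbhs_pinfty_gt; rewrite num_real.
move=> [y b] /= [gxy gb] yS; apply: le_trans (ltW gb).
rewrite -lerBlDl; apply: le_trans (ltW (gxy yS)).
by rewrite distrC lerB_dist.
Qed.

Lemma near_mx_ball (d : R) : 0 < d -> exists2 eta : R, 0 < eta <= 2 &
  forall U U' : 'M[R]_n.+1, rotations n U -> rotations n U' ->
    near_mx eta U U' ->
    forall x, sphere n x -> ball (invmx U *m x) d (invmx U' *m x).
Proof.
(* Once the entries of [U - U'] are at most [e], each coordinate of the difference is at most
   [n.+1%:R * e = d / 2]. *)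
move=> d0; pose e := d / (2 * n.+1%:R).
have e0 : 0 < e by rewrite divr_gt0// mulr_gt0.
(* The squared Frobenius norm of [U - U'] is at most [2 * eta <= e ^+ 2], and it bounds the square
   of each entry. *)
exists (Num.min 2 (e ^+ 2 / 2)).
  by rewrite lt_min ge_min lexx andbT divr_gt0 ?exprn_gt0// ltr0n.
move=> U U' rU rU'; rewrite /near_mx => nU x xS.
have [D DE] : exists D, D = U - U' by exists (U - U').
have trD : \tr (D^T *m D) = 2 * n.+1%:R - 2 * \tr (U^T *m U').
  rewrite DE [(U - U')^T]linearB /= mulmxBr !mulmxBl !rotationsTl// !linearB /=.
  by rewrite mxtrace1 -[\tr (U'^T *m U)]mxtrace_tr trmx_mul trmxK; ring.
have De k i : `|D k i| <= e.
  rewrite -(ler_pXn2r (_ : (0 < 2)%N))// ?nnegrE ?(ltW e0)//.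
  rewrite real_normK ?num_real//.
  apply: (@le_trans _ _ (\tr (D^T *m D))).
    rewrite /mxtrace (bigD1 i)//= mxE (bigD1 k)//= !mxE expr2 -addrA lerDl.
    apply: addr_ge0; first by apply: sumr_ge0 => l _;
      rewrite !mxE -expr2 sqr_ge0.
    apply: sumr_ge0 => l _; rewrite mxE; apply: sumr_ge0 => m _.
    by rewrite !mxE -expr2 sqr_ge0.
  have : Num.min 2 (e ^+ 2 / 2) <= e ^+ 2 / 2 by rewrite ge_min lexx orbT.
  by rewrite trD; lra.
rewrite !rotations_inv//; split=> // i j; rewrite (ord1 j) /ball /=.
have x1 k : `|x k 0| <= 1.
  rewrite -(@expr_le1 _ 2)// real_normK ?num_real// -xS /dotv.
  rewrite (bigD1 k)//= expr2 lerDl.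
  by apply: sumr_ge0 => l _; rewrite -expr2 sqr_ge0.
have -> : (U^T *m x) i 0 - (U'^T *m x) i 0 = \sum_k D^T i k * x k 0.
  transitivity ((D^T *m x) i 0); last by rewrite mxE.
  rewrite DE [(U - U')^T]linearB /= mulmxBl [RHS]mxE.
  by rewrite [X in _ = _ + X]mxE.
have : `|\sum_k D^T i k * x k 0| <= \sum_(k < n.+1) e.
  apply: le_trans (ler_norm_sum _ _ _) _; apply: ler_sum => k _.
  by rewrite normrM mxE -[leRHS]mulr1 ler_pM.
move=> /le_lt_trans; apply.
rewrite sumr_const card_ord -mulr_natr /e -mulrA invfM mulfVK//.
by rewrite ltr_pdivrMr//; lra.
Qed.

End UniformContinuity.

(** * Scalar products with rotated wavelets *)

Section InnerProduct.
Variables (R : realType) (n : nat) (sigma : vmeasure R n.+1).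
Hypothesis hsigma : surface_measure sigma.
Hypothesis S0 : 0 < Sigma R n.
Implicit Types f u : sphfun R n.

Local Notation S := (sphere n : set (borel 'cV[R]_n.+1)).
Local Notation Re := complex.Re.
Local Notation Im := complex.Im.

Lemma Re_conjM (z w : complex R) : Re (conjc z * w) = Re z * Re w + Im z * Im w.
Proof. by case: z w => a b [c d] /=; ring. Qed.

Lemma Im_conjM (z w : complex R) : Im (conjc z * w) = Re z * Im w - Im z * Re w.
Proof. by case: z w => a b [c d] /=; ring. Qed.

Lemma csqnorm_ge0 (z : complex R) : 0 <= csqnorm z.
Proof. by rewrite addr_ge0// sqr_ge0. Qed.

Lemma Re_inner f u : Re (inner sigma f u) = (Sigma R n)^-1 *
  \int[sigma]_(x in sphere n) (Re (f x) * Re (u x) + Im (f x) * Im (u x)).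
Proof.
rewrite /inner /cintegral /= mul0r subr0; congr (_ * _).
by apply: eq_Rintegral => x _; rewrite Re_conjM.
Qed.

Lemma Im_inner f u : Im (inner sigma f u) = (Sigma R n)^-1 *
  \int[sigma]_(x in sphere n) (Re (f x) * Im (u x) - Im (f x) * Re (u x)).
Proof.
rewrite /inner /cintegral /= mul0r addr0; congr (_ * _).
by apply: eq_Rintegral => x _; rewrite Im_conjM.
Qed.

Lemma sqnormL2E u : sqnormL2 sigma u = (Sigma R n)^-1 *
  \int[sigma]_(x in sphere n) csqnorm (u x).
Proof.
by rewrite /sqnormL2 Re_inner.
Qed.

Lemma sqnormL2_ge0 u : 0 <= sqnormL2 sigma u.
Proof.
rewrite sqnormL2E mulr_ge0 ?invr_ge0 ?(ltW S0)//.
by apply: Rintegral_ge0 => x _; exact: csqnorm_ge0.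
Qed.

Let mS : measurable S. Proof. exact: measurable_sphere. Qed.

Let sS : sigma S = (Sigma R n)%:E. Proof. by case: hsigma. Qed.

Lemma integrable_cst_sphere (c : R) : sigma.-integrable S (EFin \o fun=> c).
Proof.
apply/integrableP; split; first by apply/measurable_EFinP.
by rewrite /comp /= integral_cst// sS ltry.
Qed.

(** Serves in place of the modulus: it bounds real and imaginary parts of products without square
    roots. *)
Definition l1norm (z : complex R) : R := `|Re z| + `|Im z|.

Section FixedFunction.
Variable u : sphfun R n.
Hypothesis u2 : in_L2 sigma u.

Let mRe : measurable_fun S (fun x => Re (u x)). Proof. by case: u2 => -[]. Qed.
Let mIm : measurable_fun S (fun x => Im (u x)). Proof. by case: u2 => -[]. Qed.

Lemma integrable_csqnorm :
  sigma.-integrable S (EFin \o fun x => csqnorm (u x)).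
Proof.
have [_ ufin] := u2; apply/integrableP; split.
  apply/measurable_EFinP; apply: measurable_funD; exact: measurable_funX.
by under eq_integral do rewrite /= ger0_norm ?csqnorm_ge0//.
Qed.

(** Since [l1norm z <= 1 + csqnorm z] and the sphere has finite measure, square integrability of [u]
    suffices. *)
Lemma integrable_dominated (f : borel 'cV[R]_n.+1 -> R) (c : R) :
  measurable_fun S f -> 0 <= c ->
  (forall x, sphere n x -> `|f x| <= c * l1norm (u x)) ->
  sigma.-integrable S (EFin \o f).
Proof.
move=> mf c0 fle.
apply: (@le_integrable _ _ R sigma S mS (EFin \o f)
    (EFin \o fun x => c * (1 + csqnorm (u x)))).
- exact/measurable_EFinP.
- move=> x xS /=; rewrite lee_fin (le_trans (fle x xS))//.
  have h0 : 0 <= 1 + csqnorm (u x) by rewrite addr_ge0// csqnorm_ge0.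
  rewrite (ger0_norm (mulr_ge0 c0 h0)) ler_wpM2l//.
  rewrite /l1norm /csqnorm -(real_normK (num_real (Re _))).
  rewrite -(real_normK (num_real (Im _))).
  set p := `|_|; set q := `|_|.
  have := sqr_ge0 (p - 2^-1); have := sqr_ge0 (q - 2^-1); rewrite !sqrrB; lra.
- have I1 : sigma.-integrable S (EFin \o fun x => 1 + csqnorm (u x)).
    exact: (integrableD mS (integrable_cst_sphere 1) integrable_csqnorm).
  exact: (integrableZl mS c I1).
Qed.

Definition l1mean : R :=
  (Sigma R n)^-1 * \int[sigma]_(x in sphere n) l1norm (u x).

Lemma l1norm_ge0 z : 0 <= l1norm z.
Proof. by rewrite addr_ge0. Qed.

Lemma integrable_l1norm : sigma.-integrable S (EFin \o fun x => l1norm (u x)).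
Proof.
apply: (@integrable_dominated _ 1) => //.
  by apply: measurable_funD; apply: measurableT_comp.
by move=> x _; rewrite mul1r ger0_norm// l1norm_ge0.
Qed.

Lemma l1mean_ge0 : 0 <= l1mean.
Proof.
rewrite mulr_ge0 ?invr_ge0 ?(ltW S0)//.
by apply: Rintegral_ge0 => x _; exact: l1norm_ge0.
Qed.

(* The variance of [l1norm u] is nonnegative. *)
Lemma l1mean_sqr : l1mean ^+ 2 <= 2 * sqnormL2 sigma u.
Proof.
set N := l1mean.
have I1 := integrable_csqnorm; have I2 := integrable_l1norm.
have I3 := integrable_cst_sphere (N ^+ 2).
have IZ c (h : borel 'cV[R]_n.+1 -> R) : sigma.-integrable S (EFin \o h) ->
    sigma.-integrable S (EFin \o fun x => c * h x) by move=> Ih;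
      exact: (integrableZl mS c Ih).
have I12 : sigma.-integrable S
    (EFin \o fun x => 2 * csqnorm (u x) - 2 * N * l1norm (u x)).
  exact: (@integrableB _ _ _ _ _ mS _ _ (IZ 2 _ I1) (IZ (2 * N) _ I2)).
have : 0 <= \int[sigma]_(x in sphere n)
    ((2 * csqnorm (u x) - 2 * N * l1norm (u x)) + N ^+ 2).
  apply: Rintegral_ge0 => x _; rewrite /csqnorm /l1norm.
  rewrite -(real_normK (num_real (Re _))) -(real_normK (num_real (Im _))).
  set p := `|_|; set q := `|_|.
  have -> : 2 * (p ^+ 2 + q ^+ 2) - 2 * N * (p + q) + N ^+ 2 =
    (p + q - N) ^+ 2 + (p - q) ^+ 2 by ring.
  by rewrite addr_ge0// sqr_ge0.
rewrite RintegralD// RintegralB//; [|exact: IZ|exact: IZ].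
rewrite Rintegral_cst// sS /= !RintegralZl//.
have -> : \int[sigma]_(x in sphere n) csqnorm (u x) =
    Sigma R n * sqnormL2 sigma u.
  by rewrite sqnormL2E mulrA mulfV ?mul1r// gt_eqF.
have -> : \int[sigma]_(x in sphere n) l1norm (u x) = Sigma R n * N.
  by rewrite /N /l1mean mulrA mulfV ?mul1r// gt_eqF.
set Q := sqnormL2 _ _.
have -> : 2 * (Sigma R n * Q) - 2 * N * (Sigma R n * N) + N ^+ 2 * Sigma R n =
  Sigma R n * (2 * Q - N ^+ 2) by ring.
by rewrite pmulr_rge0// subr_ge0.
Qed.

Lemma mean_le (h : borel 'cV[R]_n.+1 -> R) c : measurable_fun S h -> 0 <= c ->
  (forall x, sphere n x -> `|h x| <= c * l1norm (u x)) ->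
  `|(Sigma R n)^-1 * \int[sigma]_(x in sphere n) h x| <= c * l1mean.
Proof.
move=> mh c0 hle.
rewrite normrM ger0_norm ?invr_ge0 ?(ltW S0)// mulrCA.
rewrite ler_wpM2l ?invr_ge0 ?(ltW S0)//.
have Ih := integrable_dominated mh c0 hle.
apply: (le_trans (le_normr_Rintegral mS Ih)).
rewrite -RintegralZl//; last exact: integrable_l1norm.
apply: le_Rintegral => //.
  exact: (integrable_norm Ih).
apply: (@integrable_dominated _ c) => //.
  apply: measurable_funM => //.
  by apply: measurable_funD; apply: measurableT_comp.
by move=> x _; rewrite ger0_norm// mulr_ge0// l1norm_ge0.
Qed.

Definition bounded_by (b : R) f : Prop :=
  forall x, sphere n x -> `|Re (f x)| <= b /\ `|Im (f x)| <= b.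

Lemma l1norm_mul (b p q : R) (z : complex R) : `|p| <= b -> `|q| <= b ->
  `|p * Re z + q * Im z| <= b * l1norm z.
Proof.
move=> pb qb; apply: (le_trans (ler_normD _ _)).
by rewrite !normrM mulrDr lerD// ler_wpM2r.
Qed.

(** Real and imaginary parts of the scalar products are at most [b * l1mean] and differ by at most
    [e * l1mean]. Factoring the differences of squares gives [2 * b * e * l1mean ^+ 2] for each
    part, and [l1mean_sqr] doubles the constant again. *)
Lemma inner_dist (f f' : sphfun R n) (b e : R) :
  measurable_cfun S f -> measurable_cfun S f' -> 0 <= b -> 0 <= e ->
  bounded_by b f -> bounded_by b f' -> bounded_by e (fun x => f x - f' x) ->
  `|csqnorm (inner sigma f u) - csqnorm (inner sigma f' u)| <=
    8 * b * e * sqnormL2 sigma u.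
Proof.
move=> [mfR mfI] [mfR' mfI'] b0 e0 bf bf' be.
pose hR (f : sphfun R n) x := Re (f x) * Re (u x) + Im (f x) * Im (u x).
pose hI (f : sphfun R n) x := Re (f x) * Im (u x) - Im (f x) * Re (u x).
have mhR g : measurable_cfun S g -> measurable_fun S (hR g).
  by move=> [mR mI]; apply: measurable_funD; exact: measurable_funM.
have mhI g : measurable_cfun S g -> measurable_fun S (hI g).
  by move=> [mR mI]; apply: measurable_funB; exact: measurable_funM.
have leR g c : bounded_by c g -> forall x, sphere n x ->
    `|hR g x| <= c * l1norm (u x).
  by move=> bg x /bg[? ?]; exact: l1norm_mul.
have leI g c : bounded_by c g -> forall x, sphere n x ->
    `|hI g x| <= c * l1norm (u x).
  move=> bg x /bg[? ?]; rewrite /hI addrC -mulNr; apply: l1norm_mul => //.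
  by rewrite normrN.
have mf : measurable_cfun S f by [].
have mf' : measurable_cfun S f' by [].
have md : measurable_cfun S (fun x => f x - f' x).
  split.
    have -> : (fun x => Re (f x - f' x)) = (fun x => Re (f x) - Re (f' x)).
      by apply/funext => x; case: (f x) (f' x) => ? ? [].
    exact: measurable_funB.
  have -> : (fun x => Im (f x - f' x)) = (fun x => Im (f x) - Im (f' x)).
    by apply/funext => x; case: (f x) (f' x) => ? ? [].
  exact: measurable_funB.
set z := inner sigma f u; set z' := inner sigma f' u.
have N0 := l1mean_ge0.
have zR : `|Re z| <= b * l1mean.
  by rewrite Re_inner; apply: mean_le (leR _ _ bf) => //; exact: mhR.
have zI : `|Im z| <= b * l1mean.
  by rewrite Im_inner; apply: mean_le (leI _ _ bf) => //; exact: mhI.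
have zR' : `|Re z'| <= b * l1mean.
  by rewrite Re_inner; apply: mean_le (leR _ _ bf') => //; exact: mhR.
have zI' : `|Im z'| <= b * l1mean.
  by rewrite Im_inner; apply: mean_le (leI _ _ bf') => //; exact: mhI.
have dR : `|Re z - Re z'| <= e * l1mean.
  rewrite !Re_inner -mulrBr -RintegralB//; first last.
  - exact: integrable_dominated (mhR _ mf') b0 (leR _ _ bf').
  - exact: integrable_dominated (mhR _ mf) b0 (leR _ _ bf).
  rewrite (_ : (fun x => _) = hR (fun x => f x - f' x)).
    by apply: mean_le (leR _ _ be) => //; exact: mhR.
  apply/funext => x; rewrite /hR.
  by case: (f x) (f' x) => ? ? [? ?] /=; ring.
have dI : `|Im z - Im z'| <= e * l1mean.
  rewrite !Im_inner -mulrBr -RintegralB//; first last.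
  - exact: integrable_dominated (mhI _ mf') b0 (leI _ _ bf').
  - exact: integrable_dominated (mhI _ mf) b0 (leI _ _ bf).
  rewrite (_ : (fun x => _) = hI (fun x => f x - f' x)).
    by apply: mean_le (leI _ _ be) => //; exact: mhI.
  apply/funext => x; rewrite /hI.
  by case: (f x) (f' x) => ? ? [? ?] /=; ring.
have sq (p q : R) : `|p| <= b * l1mean -> `|q| <= b * l1mean ->
    `|p - q| <= e * l1mean -> `|p ^+ 2 - q ^+ 2| <= 2 * b * e * l1mean ^+ 2.
  move=> hp hq hpq; rewrite subr_sqr normrM.
  have -> : 2 * b * e * l1mean ^+ 2 = e * l1mean * (b * l1mean + b * l1mean) by
    ring.
  by rewrite ler_pM// (le_trans (ler_normD _ _))// lerD.
have := sq _ _ zR zR' dR; have := sq _ _ zI zI' dI.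
have N2 := l1mean_sqr.
have : b * e * l1mean ^+ 2 <= b * e * (2 * sqnormL2 sigma u).
  by rewrite ler_wpM2l// mulr_ge0.
have -> : csqnorm z - csqnorm z' =
  (Re z ^+ 2 - Re z' ^+ 2) + (Im z ^+ 2 - Im z' ^+ 2) by rewrite /csqnorm; ring.
have := ler_normD (Re z ^+ 2 - Re z' ^+ 2) (Im z ^+ 2 - Im z' ^+ 2).
lra.
Qed.

End FixedFunction.

Definition rotated f (U : 'M[R]_n.+1) : sphfun R n := fun x => f (invmx U *m x).

Lemma rotated_near f (eps : R) : C1_sphere f ->
  (forall U, rotations n U -> in_L2 sigma (rotated f U)) -> 0 < eps ->
  exists2 eta : R, 0 < eta <= 2 &
  forall u, in_L2 sigma u -> forall U U', rotations n U -> rotations n U' ->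
    near_mx eta U U' ->
    `|csqnorm (inner sigma (rotated f U) u) -
      csqnorm (inner sigma (rotated f U') u)| <= eps * sqnormL2 sigma u.
Proof.
move=> /C1_sphere_continuous[cR cI] f2 eps0.
have [bR hR] := continuous_on_sphere_bounded cR.
have [bI hI] := continuous_on_sphere_bounded cI.
pose b : R := 1 + `|bR| + `|bI|.
have b0 : 0 < b by rewrite /b -addrA ltr_pwDl// addr_ge0.
(* Turns the bound [8 * b * e] of [inner_dist] into [eps]; the summand 1 in [b] makes the division
   legitimate. *)
pose e : R := eps / (8 * b).
have e0 : 0 < e by rewrite divr_gt0// mulr_gt0.
have [dR dR0 HR] := continuous_on_sphere_uniform cR e0.
have [dI dI0 HI] := continuous_on_sphere_uniform cI e0.
have [|eta eta2 Heta] := @near_mx_ball R n (Num.min dR dI).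
  by rewrite lt_min dR0.
exists eta => // u u2 U U' rU rU' nU.
have inS (V : 'M[R]_n.+1) (x : 'cV[R]_n.+1) : rotations n V -> sphere n x ->
  sphere n (invmx V *m x).
  move=> rV xS; rewrite rotations_inv//.
  by apply: sphere_rotation => //; exact: rotationsT.
have bf V : rotations n V -> bounded_by b (rotated f V).
  move=> rV x xS; have xV := inS V x rV xS; split.
    apply: le_trans (hR _ xV) _; apply: le_trans (ler_norm _) _.
    by rewrite /b; have := normr_ge0 bI; lra.
  apply: le_trans (hI _ xV) _; apply: le_trans (ler_norm _) _.
  by rewrite /b; have := normr_ge0 bR; lra.
have -> : eps * sqnormL2 sigma u = 8 * b * e * sqnormL2 sigma u.
  congr (_ * _); rewrite /e mulrCA mulfV ?mulr1//.
  by rewrite mulf_neq0 ?gt_eqF.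
apply: inner_dist => //.
- by have [] := f2 U rU.
- by have [] := f2 U' rU'.
- exact: ltW.
- exact: ltW.
- exact: bf.
- exact: bf.
- move=> x xS; have xB := Heta U U' rU rU' nU x xS.
  have xU := inS U x rU xS; have xU' := inS U' x rU' xS.
  have BR : ball (invmx U *m x) dR (invmx U' *m x).
    by apply: le_ball xB; rewrite ge_min lexx.
  have BI : ball (invmx U *m x) dI (invmx U' *m x).
    by apply: le_ball xB; rewrite ge_min lexx orbT.
  have := HR _ _ xU xU' BR; have := HI _ _ xU xU' BI.
  rewrite /rotated; case: (f _) (f _) => ? ? [? ?] /= ? ?.
  by split; exact: ltW.
Qed.

End InnerProduct.

(** * Integration over scales *)

Section ScaleIntegral.
Variables (R : realType) (d : measure_display) (T : measurableType d).
Local Open Scope ereal_scope.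

(** A change of variables: [at_scale j mu] is the image of [mu] under [pair j]. *)
Lemma ge0_integral_at_scale (j : nat) (mu : {measure set T -> \bar R})
    (D : set (nat * T)) (f : nat * T -> \bar R) :
  measurable D -> measurable_fun D f -> (forall y, D y -> 0 <= f y) ->
  \int[at_scale j mu]_(y in D) f y = \int[mu]_(t in xsection D j) f (j, t).
Proof.
move=> mD mf f0; have mp : measurable_fun setT (pair j : T -> nat * T).
  exact: pair1_measurable.
transitivity (\int[pushforward mu (pair j : T -> nat * T)]_(y in D) f y).
  by apply: eq_measure_integral => A mA _; rewrite /= /at_scale xsectionE.
rewrite (ge0_integral_pushforward mp)// ?xsectionE//.
by move=> y /set_mem; exact: f0.
Qed.

Lemma ge0_integral_scale_measure (w : nat -> {posnum R})
    (mu : nat -> {measure set T -> \bar R})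
    (D : set (nat * T)) (f : nat * T -> \bar R) :
  measurable D -> measurable_fun D f -> (forall y, D y -> 0 <= f y) ->
  \int[scale_measure w mu]_(y in D) f y =
  \sum_(0 <= j <oo)
    (w j)%:num%:E * \int[mu j]_(t in xsection D j) f (j, t).
Proof.
move=> mD mf f0; rewrite /scale_measure ge0_integral_measure_series//.
apply: eq_eseriesr => j _; rewrite ge0_integral_mscale//.
by rewrite ge0_integral_at_scale.
Qed.

End ScaleIntegral.

(** * From the semi-continuous to the discrete frame, with errors summable over the scales *)

Theorem theorem4p2 (R : realType) (n : nat) (hn : (0 < n)%N)
    (sigma : forall J : nat, vmeasure R J.+1)
    (hsigma : forall J : nat, (0 < J)%N -> surface_measure (sigma J))
    (nu : mxmeasure R n) (hnu : invariant_unit_measure nu)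
    (Y : forall l : nat, 'I_(Nharm n l) -> sphfun R n)
    (hY : harmonic_onb (sigma n) Y)
    (alpha : R -> R) (halpha : forall r : R, 0 < r -> 0 <= alpha r)
    (Psi : R -> sphfun R n)
    (hPsi : C1_wavelet_family (sigma n) Y alpha Psi)
    (rho : nat -> R) (hrho : forall j : nat, 0 < rho j)
    (w : nat -> {posnum R})
    (hframe : semicontinuous_frame (sigma n) nu Psi rho w) :
  exists delta : nat -> nat -> R,
    (forall j J : nat, 0 < delta j J) /\
    forall Lambda : nat -> grid R n,
      (forall j : nat, grid_of_type sigma (delta j) (Lambda j)) ->
      discrete_frame sigma Lambda Psi rho w.
Proof.
have [mD0 L2 mF [A [B [A0 AB hAB]]]] := hframe.
set D0 := [set y | _] in mD0 mF hAB.
have S0 := Sigma_gt0 R hn; have hS := hsigma n hn.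
set M := total_mass R n; have M0 : 0 < M by exact: total_mass_gt0.
have xD0 j : xsection D0 j = rotations n.
  by apply/seteqP; split=> U; rewrite /xsection /= inE.
(* SO(n+1) is a section of the index set of the given frame, whose measurability belongs to
   [is_frame]. *)
have mrot : measurable (rotations n : set (borel 'M[R]_n.+1)).
  by rewrite -(xD0 0%N); exact: measurable_xsection.
pose F j u (U : borel 'M[R]_n.+1) :=
  csqnorm (inner (sigma n) (rotated (Psi (rho j)) U) u).
pose G u (y : nat * borel 'M[R]_n.+1) :=
  csqnorm (inner (sigma n) (rotated_wavelets Psi rho y) u).
have mG u : in_L2 (sigma n) u -> measurable_fun D0 (G u).
  move=> /mF[mR mI]; apply: measurable_funD; exact: measurable_funX.
have mFj j u : in_L2 (sigma n) u ->
    measurable_fun (rotations n : set (borel 'M[R]_n.+1)) (F j u).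
  move=> /mG mGu; apply: (@measurable_comp _ _ _ _ _ _ D0 (G u)
    (rotations n : set (borel 'M[R]_n.+1)) (pair j)) => //.
    by move=> _ [U rU <-].
  by apply: (@measurable_funS _ _ _ _ setT) => //; exact: pair1_measurable.
(* Chosen so that the error of [grid_sum_integral], multiplied by the weight [w j], is
   [C / 2 ^ j.+1] with [C] as below. *)
pose eps j := A / (2 * n%:R * (w j)%:num * 2 ^+ j.+1).
have n0 : 0 < n%:R :> R by rewrite ltr0n.
have eps0 j : 0 < eps j by rewrite divr_gt0// !mulr_gt0// exprn_gt0.
have /choice[eta Heta] (j : nat) : exists eta : R, 0 < eta <= 2 /\
    forall u, in_L2 (sigma n) u -> forall U U', rotations n U ->
      rotations n U' -> near_mx eta U U' ->
      `|F j u U - F j u U'| <= eps j * sqnormL2 (sigma n) u.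
  have [|eta eta2 H] := rotated_near hS S0 (hPsi.2 (rho j) (hrho j)) _ (eps0 j).
    by move=> U rU; exact: (L2 (j, U)).
  by exists eta.
(* One radius serves all levels of the grid at scale [j]; it is fixed before the grids and the
   function [u]. *)
exists (fun j _ => radius (eta j)); split=> [j J|Lambda gL].
  by apply: radius_gt0; case: (Heta j).
pose D := [set y : nat * borel 'M[R]_n.+1 | grid_set (Lambda y.1) 1%:M y.2].
have DD0 : D `<=` D0.
  by move=> [j U] /=; apply: grid_set_rotations => //; exact: rotations1.
have xD j : xsection D j = grid_set (Lambda j) 1%:M.
  by apply/seteqP; split=> U; rewrite /xsection /= inE.
have mD : measurable D.
  have -> : D = \bigcup_j ([set j] `*` grid_set (Lambda j) 1%:M).
    apply/seteqP; split=> [[j U] /= gU|[j U] [i _ [/= ->]]//].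
    by exists j.
  by apply: bigcup_measurable => j _; apply: measurableX => //;
    exact: measurable_grid_set.
split => //.
- by move=> y /DD0; exact: L2.
- by move=> u /mF[mR mI]; split;
    [exact: measurable_funS mR|exact: measurable_funS mI].
(* The grid mass [M] rescales the given bounds to [M * A] and [M * B]; the total error takes half of
   the former and is added to the latter. *)
exists (M * A / 2), (M * (B + A / 2)); split.
- by rewrite divr_gt0// mulr_gt0.
- by rewrite -mulrA ler_pM2l//; lra.
move=> u u2; set Q := sqnormL2 (sigma n) u.
have Q0 : 0 <= Q by exact: sqnormL2_ge0.
have /andP[hA hB] := hAB u u2.
pose C := M * A / 2 * Q.
have C0 : 0 <= C by rewrite !mulr_ge0// ?ltW.
pose a j := (\int[nu]_(U in rotations n) (F j u U)%:E)%E.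
have a0 j : (0 <= a j)%E.
  by apply: integral_ge0 => U _; rewrite lee_fin csqnorm_ge0.
pose b j := grid_sum sigma (Lambda j) (F j u).
have bE j : (\int[grid_measure sigma (Lambda j) 1%:M]_(U in
    grid_set (Lambda j) 1%:M) (F j u U)%:E)%E = (b j)%:E.
  rewrite (@integral_grid_measure _ _ n n (Lambda j) id).
  - by rewrite /b; congr (grid_sum _ _ _)%:E; apply/funext => U; rewrite mulmx1.
  - by [].
  - by [].
  - by [].
  - exact: measurable_grid_set.
  - by [].
  - apply: measurable_funS (mFj j u u2) => //.
    by apply: grid_set_rotations => //; exact: rotations1.
  - by move=> U _; exact: csqnorm_ge0.
have b0 j : 0 <= b j.
  by rewrite -lee_fin -bE; apply: integral_ge0 => U _;
    rewrite lee_fin csqnorm_ge0.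
have ab j : (((w j)%:num * b j)%:E <=
      M%:E * ((w j)%:num%:E * a j) + (C / (2 ^ j.+1)%:R)%:E /\
    M%:E * ((w j)%:num%:E * a j) <=
      ((w j)%:num * b j)%:E + (C / (2 ^ j.+1)%:R)%:E)%E.
  have [eta2 H] := Heta j.
  have eQ : 0 <= eps j * Q by rewrite mulr_ge0// ltW.
  have [h1 h2] := grid_sum_integral hsigma hnu mrot eta2 eQ (gL j)
    (mFj j u u2) (fun V _ => csqnorm_ge0 _) (H u u2).
  have wc : (C / (2 ^ j.+1)%:R) = (w j)%:num * (n%:R * (eps j * Q) * M).
    rewrite natrX /C /eps; field.
    by rewrite !gt_eqF// exprn_gt0.
  rewrite wc -/Q; set c := n%:R * (eps j * Q) * M.
  rewrite (EFinM _ (b j)) (EFinM _ c) muleCA -!muleDr ?fin_num_adde_defl//.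
  by rewrite !lee_pmul2l// lte_fin.
pose Sa := (\sum_(0 <= j <oo) ((w j)%:num%:E * a j))%E.
pose Sb := (\sum_(0 <= j <oo) ((w j)%:num * b j)%:E)%E.
have SaE : (\int[scale_measure w (fun=> nu)]_(y in D0) (G u y)%:E = Sa)%E.
  rewrite ge0_integral_scale_measure//; first last.
  - by move=> y _; rewrite lee_fin csqnorm_ge0.
  - by apply/measurable_EFinP; exact: mG.
  by apply: eq_eseriesr => j _; congr (_ * integral _ _ _)%E; exact: xD0.
have SbE : (\int[scale_measure w (fun j => grid_measure sigma (Lambda j)
  1%:M)]_(y
    in D) (G u y)%:E = Sb)%E.
  rewrite ge0_integral_scale_measure//; first last.
  - by move=> y _; rewrite lee_fin csqnorm_ge0.
  - by apply/measurable_EFinP; exact: measurable_funS (mG u u2).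
  apply: eq_eseriesr => j _; rewrite EFinM -bE.
  by congr (_ * integral _ _ _)%E; exact: xD.
rewrite [X in (_ <= X <= _)%E]SbE; rewrite SaE -/Q in hA hB.
have MSa : (M%:E * Sa = \sum_(0 <= j <oo) M%:E * ((w j)%:num%:E * a j))%E.
  by rewrite nneseriesZl// => j _; rewrite mule_ge0.
have wb0 j : (0 <= ((w j)%:num * b j)%:E)%E by rewrite lee_fin mulr_ge0.
have wa0 j : (0 <= M%:E * ((w j)%:num%:E * a j))%E.
  by rewrite !mule_ge0// lee_fin ltW.
(* By [epsilon_trick] the errors [C / 2 ^ j.+1] add up to at most [C] over all scales. *)
have SaSb : (M%:E * Sa <= Sb + C%:E)%E.
  rewrite MSa; apply: le_trans (epsilon_trick xpredT wb0 C0).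
  by apply: lee_nneseries => j *; [exact: wa0|have [] := ab j].
have SbSa : (Sb <= M%:E * Sa + C%:E)%E.
  rewrite MSa; apply: le_trans (epsilon_trick xpredT wa0 C0).
  by apply: lee_nneseries => j *; [exact: wb0|have [] := ab j].
apply/andP; split.
  have : (M%:E * (A * Q)%:E <= M%:E * Sa)%E by rewrite lee_pmul2l.
  move=> /le_trans/(_ SaSb); rewrite -leeBlDr// -EFinM -EFinB.
  by congr (_%:E <= _)%E; rewrite /C; field.
apply: (le_trans SbSa).
have : (M%:E * Sa <= M%:E * (B * Q)%:E)%E by rewrite lee_pmul2l.
move=> /(leeD2r C%:E)/le_trans; apply.
rewrite -EFinM -EFinD lee_fin /C; lra.
Qed.
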